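(* Let $E$ be a finite directed graph and let $\mathcal{P}_K(E)$ be its path algebra with coefficients in a field $K$. Then there is an isomorphism of $\mathbb{Z}[t,t^{-1}]$-modules $$K_0^{\mathrm{gr}}(\mathcal{P}_K(E))\;\cong\;\bigoplus_{|E^0|}\mathbb{Z}[t,t^{-1}],$$ a direct sum of copies of $\mathbb{Z}[t,t^{-1}]$ indexed by the vertices of $E$.
   Context: A finite directed graph $E=(E^0,E^1,r,s)$ has finite sets of vertices $E^0$ and edges $E^1$ and range and source maps $r,s:E^1\to E^0$. The path algebra $\mathcal{P}_K(E)$ is the $K$-algebra generated by $\{v:v\in E^0\}\cup\{\alpha:\alpha\in E^1\}$ subject to $vw=\delta_{v,w}v$ for $v,w\in E^0$ and $s(\alpha)\alpha=\alpha r(\alpha)=\alpha$ for $\alpha\in E^1$; it is $\mathbb{Z}$-graded by $\deg v=0$, $\deg\alpha=1$. For a $\mathbb{Z}$-graded unital ring $B$, $K_0^{\mathrm{gr}}(B)$ is the group completion of the monoid (under $\oplus$) of graded isomorphism classes of graded finitely generated projective right $B$-modules; it is a $\mathbb{Z}[t,t^{-1}]$-module, where the group $\mathbb{Z}=\langle t\rangle$ acts through the shifts $P\mapsto P(k)$, $P(k)_j=P_{k+j}$. *)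

(* Defs.v *)
From HB Require Import structures.
From mathcomp Require Import all_boot all_order all_algebra finmap.
From mathcomp Require Import boolp.
From mathcomp Require Import monalg.

Set Implicit Arguments.
Unset Strict Implicit.
Unset Printing Implicit Defensive.

Import Order.TTheory GRing.Theory Num.Theory.
Local Open Scope fset_scope.
Local Open Scope ring_scope.
Local Open Scope quotient_scope.

(* The isomorphism classes of modules over a ring [B : pzRingType] live one
   universe above the carriers allowed in the (monomorphic) hierarchy of
   MathComp, so that they cannot form an [nmodType] or an [lmodType]. The
   records below are the same structures on types of an arbitrary universe,
   with Leibniz equality. *)

Record cMonoid := CMonoid {
  cm_sort :> Type;
  cm_zero : cm_sort;
  cm_add : cm_sort -> cm_sort -> cm_sort;
  cm_addA : associative cm_add;
  cm_addC : commutative cm_add;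
  cm_add0 : left_id cm_zero cm_add
}.

Record abGroup := AbGroup {
  ag_sort :> Type;
  ag_zero : ag_sort;
  ag_add : ag_sort -> ag_sort -> ag_sort;
  ag_opp : ag_sort -> ag_sort;
  ag_addA : associative ag_add;
  ag_addC : commutative ag_add;
  ag_add0 : left_id ag_zero ag_add;
  ag_addN : left_inverse ag_zero ag_opp ag_add
}.

Record lModule (R : pzRingType) := LModule {
  lm_group :> abGroup;
  lm_scale : R -> lm_group -> lm_group;
  lm_scaleA : forall a b x, lm_scale a (lm_scale b x) = lm_scale (a * b) x;
  lm_scale1 : forall x, lm_scale 1 x = x;
  lm_scaleDr : forall a x y,
    lm_scale a (ag_add x y) = ag_add (lm_scale a x) (lm_scale a y);
  lm_scaleDl : forall a b x,
    lm_scale (a + b) x = ag_add (lm_scale a x) (lm_scale b x)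
}.

Definition abGroup_of_zmodType (V : zmodType) : abGroup :=
  @AbGroup V 0 +%R -%R (@addrA V) (@addrC V) (@add0r V) (@addNr V).

Definition lModule_of_lmodType (R : pzRingType) (V : lmodType R) : lModule R :=
  @LModule R (abGroup_of_zmodType V) *:%R (@scalerA R V) (@scale1r R V)
    (@scalerDr R V) (fun a b x => @scalerDl R V x a b).

Definition lModule_iso (R : pzRingType) (M N : lModule R) : Prop :=
  exists f : M -> N,
    [/\ bijective f,
        forall x y, f (ag_add x y) = ag_add (f x) (f y) &
        forall a x, f (lm_scale a x) = lm_scale a (f x)].

Section Quotient.
Variables (T : Type) (R : T -> T -> Prop).

Record is_equivalence : Prop := IsEquivalence {
  eqv_refl : forall x, R x x;
  eqv_sym : forall x y, R x y -> R y x;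
  eqv_trans : forall x y z, R x y -> R y z -> R x z
}.

Definition quot : Type := {S : T -> Prop | exists x, S = R x}.

Definition quot_class (x : T) : quot :=
  exist _ (R x) (ex_intro (fun y => R x = R y) x erefl).

Definition quot_repr (q : quot) : T := sval (cid (proj2_sig q)).

Lemma quot_reprK q : quot_class (quot_repr q) = q.
Proof.
rewrite /quot_repr; case: cid => x /= qx; case: q qx => S HS /= qx.
by apply: eq_exist.
Qed.

Hypothesis R_eqv : is_equivalence.

Lemma quot_classP x y : quot_class x = quot_class y <-> R x y.
Proof.
split=> [[/(congr1 (fun S => S y))]|xRy].
  by move=> ->; apply: eqv_refl.
apply: eq_exist; apply/funext => z; apply/propext.
split; last exact: (eqv_trans R_eqv).
by apply: (eqv_trans R_eqv); apply: (eqv_sym R_eqv).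
Qed.

Lemma quot_class_repr x : R (quot_repr (quot_class x)) x.
Proof. by apply/quot_classP; rewrite quot_reprK. Qed.

Lemma quot_classS q : exists x, q = quot_class x.
Proof. by exists (quot_repr q); rewrite quot_reprK. Qed.

End Quotient.

Definition quot_map (T : Type) (R : T -> T -> Prop) (f : T -> T)
  (q : quot R) : quot R := quot_class R (f (quot_repr q)).

Definition quot_map2 (T : Type) (R : T -> T -> Prop) (f : T -> T -> T)
  (p q : quot R) : quot R := quot_class R (f (quot_repr p) (quot_repr q)).

Lemma quot_mapE (T : Type) (R : T -> T -> Prop) (f : T -> T) :
  is_equivalence R -> (forall x y, R x y -> R (f x) (f y)) ->
  forall x, quot_map f (quot_class R x) = quot_class R (f x).
Proof.
move=> eqR fR x; apply/quot_classP => //.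
by apply: fR; apply: quot_class_repr.
Qed.

Lemma quot_map2E (T : Type) (R : T -> T -> Prop) (f : T -> T -> T) :
  is_equivalence R ->
  (forall x x' y y', R x x' -> R y y' -> R (f x y) (f x' y')) ->
  forall x y,
    quot_map2 f (quot_class R x) (quot_class R y) = quot_class R (f x y).
Proof.
move=> eqR fR x y; apply/quot_classP => //.
by apply: fR; apply: quot_class_repr.
Qed.

Section GroupCompletion.
Variable M : cMonoid.
Local Notation "x + y" := (cm_add x y).

HB.instance Definition _ :=
  Monoid.isComLaw.Build M (cm_zero M) (@cm_add M)
    (@cm_addA M) (@cm_addC M) (@cm_add0 M).

(* The pair (a, b) stands for the formal difference a - b. *)
Definition gc_rel (p q : M * M) : Prop :=
  exists e, (p.1 + q.2) + e = (q.1 + p.2) + e.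

Lemma gc_rel_eqv : is_equivalence gc_rel.
Proof.
split=> [x|x y [e E]|[x1 x2] [y1 y2] [z1 z2] [e /= E] [d /= D]].
- by exists (cm_zero M).
- by exists e.
exists ((y1 + y2) + (e + d)) => /=.
rewrite [LHS](@cm_add M).[AC (2*(2*2)) ((1*4*5)*(3*2*6))] E D.
by rewrite [LHS](@cm_add M).[AC (3*3) ((4*2)*((1*5)*(3*6)))].
Qed.

Definition gc_pair_add (p q : M * M) : M * M := (p.1 + q.1, p.2 + q.2).
Definition gc_pair_opp (p : M * M) : M * M := (p.2, p.1).

Lemma gc_pair_add_rel p p' q q' :
  gc_rel p p' -> gc_rel q q' -> gc_rel (gc_pair_add p q) (gc_pair_add p' q').
Proof.
case: p p' q q' => [p1 p2] [p1' p2'] [q1 q2] [q1' q2'] [e /= E] [d /= D].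
exists (e + d) => /=.
rewrite [LHS](@cm_add M).[AC (2*2*2) ((1*3*5)*(2*4*6))] E D.
by rewrite [LHS](@cm_add M).[AC (3*3) ((1*4*(2*5))*(3*6))].
Qed.

Lemma gc_pair_opp_rel p p' :
  gc_rel p p' -> gc_rel (gc_pair_opp p) (gc_pair_opp p').
Proof.
case: p p' => [p1 p2] [p1' p2'] [e /= E]; exists e => /=.
by rewrite [p2 + _]cm_addC [p2' + _]cm_addC.
Qed.

Definition gc_add := quot_map2 (R := gc_rel) gc_pair_add.
Definition gc_opp := quot_map (R := gc_rel) gc_pair_opp.
Definition gc_zero := quot_class gc_rel (cm_zero M, cm_zero M).

Lemma gc_addE p q :
  gc_add (quot_class gc_rel p) (quot_class gc_rel q)
  = quot_class gc_rel (gc_pair_add p q).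
Proof.
apply: quot_map2E => [|x x' y y']; first exact: gc_rel_eqv.
exact: gc_pair_add_rel.
Qed.

Lemma gc_oppE p :
  gc_opp (quot_class gc_rel p) = quot_class gc_rel (gc_pair_opp p).
Proof.
by apply: quot_mapE => [|x y]; [apply: gc_rel_eqv|apply: gc_pair_opp_rel].
Qed.

Lemma gc_addA : associative gc_add.
Proof.
move=> qx qy qz; have [x ->] := quot_classS qx; have [y ->] := quot_classS qy.
have [z ->] := quot_classS qz.
by rewrite !gc_addE /gc_pair_add /= !cm_addA.
Qed.

Lemma gc_addC : commutative gc_add.
Proof.
move=> qx qy; have [x ->] := quot_classS qx; have [y ->] := quot_classS qy.
rewrite !gc_addE /gc_pair_add.
by rewrite [x.1 + _]cm_addC [x.2 + _]cm_addC.
Qed.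

Lemma gc_add0 : left_id gc_zero gc_add.
Proof.
move=> q; have [[x y] ->] := quot_classS q.
by rewrite gc_addE /gc_pair_add /= !cm_add0.
Qed.

Lemma gc_addN : left_inverse gc_zero gc_opp gc_add.
Proof.
move=> q; have [[x y] ->] := quot_classS q.
rewrite gc_oppE gc_addE /gc_pair_add /=.
apply/(quot_classP (@gc_rel_eqv)).
exists (cm_zero M) => /=.
by congr (_ + _); rewrite cm_addC [y + x]cm_addC.
Qed.

Definition group_completion : abGroup :=
  AbGroup gc_addA gc_addC gc_add0 gc_addN.

Definition gc_pair_map (f : M -> M) (p : M * M) : M * M := (f p.1, f p.2).

Definition gc_map (f : M -> M) : group_completion -> group_completion :=
  quot_map (R := gc_rel) (gc_pair_map f).

Lemma gc_mapE (f : M -> M) : {morph f : x y / x + y} -> forall p,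
  gc_map f (quot_class gc_rel p) = quot_class gc_rel (gc_pair_map f p).
Proof.
move=> fD; apply: quot_mapE; first exact: gc_rel_eqv.
by move=> x y [e E]; exists (f e); rewrite /= -!fD E.
Qed.

Lemma gc_map_add (f : M -> M) : {morph f : x y / x + y} -> forall x y,
  gc_map f (ag_add x y) = ag_add (gc_map f x) (gc_map f y).
Proof.
move=> fD qx qy; have [x ->] := quot_classS qx.
have [y ->] := quot_classS qy => /=.
by rewrite gc_addE !gc_mapE // gc_addE /gc_pair_map /gc_pair_add /= !fD.
Qed.

End GroupCompletion.

(* The formal sum of the c_k t^k (k : int) is represented by the finitely
   supported family of its coefficients; [<< c *g k >>] is the monomial c t^k.
   The library turns [{malg R[G]}] into a ring only for monoids G without
   nontrivial units, whence the direct definition of the product. *)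
Definition laurent : Type := {malg int[int]}.
HB.instance Definition _ := GRing.Zmodule.on laurent.

Section Laurent.
Implicit Types f g : laurent.

Definition laurent_mul f g : laurent :=
  \sum_(i <- msupp f) \sum_(j <- msupp g) << f@_i * g@_j *g i + j >>.

Definition laurent_one : laurent := << 1 *g 0 >>.

Lemma laurent_mulw (d1 d2 : {fset int}) f g :
  msupp f `<=` d1 -> msupp g `<=` d2 ->
  laurent_mul f g
  = \sum_(i <- d1) \sum_(j <- d2) << f@_i * g@_j *g i + j >>.
Proof.
move=> le1 le2; rewrite /laurent_mul (big_fset_incl _ le1) /=.
  apply/eq_bigr=> i _; apply/big_fset_incl => // k _ /mcoeff_outdom ->.
  by rewrite mulr0 monalgU0.
move=> k _ /mcoeff_outdom fk.
by rewrite big1 => // j _; rewrite fk mul0r monalgU0.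
Qed.

Lemma laurent_mulUU (a b i j : int) :
  laurent_mul << a *g i >> << b *g j >> = << a * b *g i + j >>.
Proof.
by rewrite (laurent_mulw msuppU_le msuppU_le) !big_seq_fset1 !mcoeffUU.
Qed.

Lemma laurent_mulC : commutative laurent_mul.
Proof.
move=> f g; rewrite /laurent_mul exchange_big; apply: eq_bigr => i _.
by apply: eq_bigr => j _; rewrite mulrC addrC.
Qed.

Lemma laurent_mulDl : left_distributive laurent_mul +%R.
Proof.
move=> f g h.
rewrite (laurent_mulw (msuppD_le f g) (fsubset_refl (msupp h))).
rewrite (laurent_mulw (fsubsetUl _ (msupp g)) (fsubset_refl (msupp h))).
rewrite (laurent_mulw (fsubsetUr (msupp f) _) (fsubset_refl (msupp h))).
rewrite -big_split /=; apply/eq_bigr=> i _.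
rewrite -big_split /=; apply/eq_bigr=> j _.
by rewrite mcoeffD mulrDl monalgUD.
Qed.

Lemma laurent_mulDr : right_distributive laurent_mul +%R.
Proof.
by move=> f g h; rewrite ![laurent_mul f _]laurent_mulC laurent_mulDl.
Qed.

Lemma laurent_mul0 g : laurent_mul 0 g = 0.
Proof. by rewrite /laurent_mul msupp0 big_seq_fset0. Qed.

Lemma laurent_mul_suml (I : Type) (s : seq I) (F : I -> laurent) g :
  laurent_mul (\sum_(i <- s) F i) g = \sum_(i <- s) laurent_mul (F i) g.
Proof.
apply: (big_morph (laurent_mul^~ g)); last exact: laurent_mul0.
by move=> x y; rewrite laurent_mulDl.
Qed.

Lemma laurent_mul_sumr (I : Type) (s : seq I) (F : I -> laurent) g :
  laurent_mul g (\sum_(i <- s) F i) = \sum_(i <- s) laurent_mul g (F i).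
Proof.
by rewrite laurent_mulC laurent_mul_suml; apply: eq_bigr => i _;
  rewrite laurent_mulC.
Qed.

Lemma laurent_mulA : associative laurent_mul.
Proof.
move=> f g h; rewrite [f]monalgE [g]monalgE [h]monalgE.
pose U p (k : int) : laurent := << mcoeff k p *g k >>.
rewrite !(laurent_mul_suml (msupp f) (U f)) laurent_mul_suml.
apply: eq_bigr => i _.
rewrite (laurent_mul_suml (msupp g) (U g)).
rewrite !(laurent_mul_sumr (msupp g) _ (U f i)).
rewrite laurent_mul_suml.
apply: eq_bigr => j _.
rewrite !(laurent_mul_sumr (msupp h) (U h)) laurent_mul_sumr.
apply: eq_bigr => k _.
by rewrite !laurent_mulUU mulrA addrA.
Qed.

Lemma laurent_mul1 : left_id laurent_one laurent_mul.
Proof.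
move=> f; rewrite {1}[f]monalgE laurent_mul_sumr [RHS]monalgE.
by apply: eq_bigr => i _; rewrite laurent_mulUU mul1r add0r.
Qed.

Lemma laurent_one_neq0 : laurent_one != 0.
Proof. by rewrite monalgU_eq0. Qed.

End Laurent.

HB.instance Definition _ := GRing.Zmodule_isComNzRing.Build laurent
  laurent_mulA laurent_mulC laurent_mul1 laurent_mulDl laurent_one_neq0.

Section IntMul.
Variable A : abGroup.
Local Notation "x +' y" := (ag_add x y) (at level 50, left associativity).
Local Notation "0'" := (ag_zero A).

HB.instance Definition _ :=
  Monoid.isComLaw.Build A (ag_zero A) (@ag_add A)
    (@ag_addA A) (@ag_addC A) (@ag_add0 A).

Implicit Types x y z : A.

Definition ag_mulz (n : int) (x : A) : A :=
  match n with
  | Posz m => iter m (@ag_add A x) 0'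
  | Negz m => ag_opp (iter m.+1 (@ag_add A x) 0')
  end.

Lemma ag_addr0 x : x +' 0' = x.
Proof. by rewrite ag_addC ag_add0. Qed.

Lemma ag_addrN x : x +' ag_opp x = 0'.
Proof. by rewrite ag_addC ag_addN. Qed.

Lemma ag_addKr x y : ag_opp x +' (x +' y) = y.
Proof. by rewrite ag_addA ag_addN ag_add0. Qed.

Lemma ag_addIr x y z : x +' y = x +' z -> y = z.
Proof. by move=> /(congr1 (ag_add (ag_opp x))); rewrite !ag_addKr. Qed.

Lemma ag_oppD x y : ag_opp (x +' y) = ag_opp x +' ag_opp y.
Proof.
apply: (@ag_addIr (x +' y)); rewrite ag_addrN.
by rewrite (@ag_add A).[AC (2*2) ((1*3)*(2*4))] !ag_addrN ag_add0.
Qed.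

Lemma ag_mulz0 x : ag_mulz 0 x = 0'.
Proof. by []. Qed.

Lemma ag_mulz1 x : ag_mulz 1 x = x.
Proof. by rewrite /= ag_addr0. Qed.

Lemma ag_mulzS n x : ag_mulz (n + 1) x = x +' ag_mulz n x.
Proof.
case: n => [n|[|n]]; first by rewrite -PoszD addn1.
  by rewrite /= ag_addr0 ag_addrN.
rewrite (_ : Negz n.+1 + 1 = Negz n); last first.
  by rewrite !NegzE -addn1 PoszD opprD addrNK.
by rewrite /= [in RHS]ag_oppD ag_addA ag_addrN ag_add0.
Qed.

Lemma ag_mulzP n x : ag_mulz (n - 1) x = ag_opp x +' ag_mulz n x.
Proof. by rewrite -[in RHS](subrK 1 n) ag_mulzS ag_addKr. Qed.

Lemma int_succ_ind (P : int -> Prop) :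
  P 0 -> (forall n, P n -> P (n + 1)) -> (forall n, P n -> P (n - 1)) ->
  forall n, P n.
Proof.
move=> P0 PS PP; elim=> [//|n /PS|n /PP]; first by rewrite -PoszD addn1.
by rewrite -opprD -PoszD addn1.
Qed.

Lemma ag_mulzDl m n x : ag_mulz (m + n) x = ag_mulz m x +' ag_mulz n x.
Proof.
elim/int_succ_ind: m => [|m IH|m IH]; first by rewrite add0r ag_add0.
  by rewrite addrAC !ag_mulzS IH ag_addA.
by rewrite addrAC !ag_mulzP IH ag_addA.
Qed.

Lemma ag_mulzDr n x y : ag_mulz n (x +' y) = ag_mulz n x +' ag_mulz n y.
Proof.
elim/int_succ_ind: n => [|n IH|n IH]; first by rewrite !ag_mulz0 ag_add0.
  by rewrite !ag_mulzS IH (@ag_add A).[AC (2*2) ((1*3)*(2*4))].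
by rewrite !ag_mulzP IH ag_oppD (@ag_add A).[AC (2*2) ((1*3)*(2*4))].
Qed.

Lemma ag_mulzr0 n : ag_mulz n 0' = 0'.
Proof.
by apply: (@ag_addIr (ag_mulz n 0')); rewrite -ag_mulzDr !ag_addr0.
Qed.

Lemma ag_mulzA m n x : ag_mulz m (ag_mulz n x) = ag_mulz (m * n) x.
Proof.
elim/int_succ_ind: m => [|m IH|m IH]; first by rewrite mul0r.
  by rewrite ag_mulzS IH mulrDl mul1r addrC ag_mulzDl.
rewrite ag_mulzP IH mulrBl mul1r; apply: (@ag_addIr (ag_mulz n x)).
by rewrite ag_addA ag_addrN ag_add0 -ag_mulzDl addrC subrK.
Qed.

Variable h : A -> A.
Hypothesis hD : {morph h : x y / x +' y}.

Lemma ag_morph0 : h 0' = 0'.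
Proof. by apply: (@ag_addIr (h 0')); rewrite -hD !ag_addr0. Qed.

Lemma ag_morphN x : h (ag_opp x) = ag_opp (h x).
Proof.
by apply: (@ag_addIr (h x)); rewrite -hD !ag_addrN ag_morph0.
Qed.

Lemma ag_morph_mulz n x : h (ag_mulz n x) = ag_mulz n (h x).
Proof.
elim/int_succ_ind: n => [|n IH|n IH]; first by rewrite !ag_mulz0 ag_morph0.
  by rewrite !ag_mulzS hD IH.
by rewrite !ag_mulzP hD ag_morphN IH.
Qed.

End IntMul.

Section LaurentModule.
Variables (A : abGroup) (act : int -> A -> A).
Hypothesis actD : forall k, {morph act k : x y / ag_add x y}.
Hypothesis act0 : forall x, act 0 x = x.
Hypothesis actA : forall i j x, act i (act j x) = act (i + j) x.
Implicit Types (f g : laurent) (x : A).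

(* The action of [f] for which t^k acts as [act k]. *)
Definition laurent_act f x : A :=
  \big[@ag_add A/ag_zero A]_(k <- msupp f) ag_mulz f@_k (act k x).

Lemma laurent_actw (d : {fset int}) f x : msupp f `<=` d ->
  laurent_act f x
  = \big[@ag_add A/ag_zero A]_(k <- d) ag_mulz f@_k (act k x).
Proof. by move=> le_d; apply: big_fset_incl => // k _ /mcoeff_outdom ->. Qed.

Lemma laurent_actU (a k : int) x :
  laurent_act << a *g k >> x = ag_mulz a (act k x).
Proof. by rewrite (laurent_actw _ msuppU_le) big_seq_fset1 mcoeffUU. Qed.

Lemma laurent_actDl f g x :
  laurent_act (f + g) x = ag_add (laurent_act f x) (laurent_act g x).
Proof.
rewrite (laurent_actw _ (msuppD_le f g)).
rewrite (laurent_actw _ (fsubsetUl _ (msupp g))).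
rewrite (laurent_actw _ (fsubsetUr (msupp f) _)).
by rewrite -big_split /=; apply: eq_bigr => k _; rewrite mcoeffD ag_mulzDl.
Qed.

Lemma laurent_act0l x : laurent_act 0 x = ag_zero A.
Proof. by rewrite /laurent_act msupp0 big_seq_fset0. Qed.

Lemma laurent_actDr f x y :
  laurent_act f (ag_add x y) = ag_add (laurent_act f x) (laurent_act f y).
Proof.
by rewrite -big_split; apply: eq_bigr => k _; rewrite actD ag_mulzDr.
Qed.

Lemma laurent_act1 x : laurent_act 1 x = x.
Proof. by rewrite laurent_actU ag_mulz1 act0. Qed.

Lemma laurent_actA f g x :
  laurent_act f (laurent_act g x) = laurent_act (f * g) x.
Proof.
have actl := big_morph (laurent_act^~ x)
  (fun f g => laurent_actDl f g x) (laurent_act0l x).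
rewrite [f * g]/(laurent_mul f g) /laurent_mul actl.
apply: eq_bigr => i _; rewrite actl.
have mD : {morph (fun y => ag_mulz f@_i (act i y)) : y z / ag_add y z}.
  by move=> y z; rewrite actD ag_mulzDr.
rewrite /laurent_act (big_morph _ mD (ag_morph0 mD)).
apply: eq_bigr => j _.
by rewrite -/(laurent_act _ _) laurent_actU ag_morph_mulz // actA ag_mulzA.
Qed.

Definition laurent_module : lModule laurent :=
  LModule laurent_actA laurent_act1 laurent_actDr
    (fun f g x => laurent_actDl f g x).

End LaurentModule.

(* [V] is the internal direct sum of the subgroups [G i], [i : int]. *)
Record is_grading (V : zmodType) (G : int -> V -> Prop) : Prop := IsGrading {
  grading0 : forall i, G i 0;
  gradingB : forall i x y, G i x -> G i y -> G i (x - y);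
  grading_span : forall x, exists (s : seq int) (c : int -> V),
    [/\ uniq s, forall i, G i (c i) & x = \sum_(i <- s) c i];
  grading_free : forall (s : seq int) (c : int -> V),
    uniq s -> (forall i, G i (c i)) -> \sum_(i <- s) c i = 0 ->
    forall i, i \in s -> c i = 0
}.

Record grRing := GrRing {
  gr_ring :> pzRingType;
  gr_deg : int -> gr_ring -> Prop;
  gr_ring_grading : is_grading gr_deg;
  gr_deg1 : gr_deg 0 1;
  gr_degM : forall i j x y, gr_deg i x -> gr_deg j y -> gr_deg (i + j) (x * y)
}.

(* Right [B]-modules are left modules over the converse ring [B^c]: for
   [x : M] and [b : B], [(b : B^c) *: x] is x . b. *)
Record grModule (B : grRing) := GrModule {
  gm_mod :> lmodType B^c;
  gm_deg : int -> gm_mod -> Prop;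
  gm_grading : is_grading gm_deg;
  gm_degZ : forall i j (x : gm_mod) (b : B),
    gm_deg i x -> gr_deg j b -> gm_deg (i + j) ((b : B^c) *: x)
}.

Section GradingLemmas.
Variables (V : zmodType) (G : int -> V -> Prop).
Hypothesis G0 : forall i, G i 0.
Hypothesis GB : forall i x y, G i x -> G i y -> G i (x - y).

Lemma gradingD_of i x y : G i x -> G i y -> G i (x + y).
Proof.
by move=> Gx Gy; rewrite -[y]opprK; apply: GB => //; rewrite -sub0r; apply: GB.
Qed.

Lemma grading_span_of x :
  (exists2 L : seq (int * V), (forall p, p \in L -> G p.1 p.2) &
     x = \sum_(p <- L) p.2) ->
  exists (s : seq int) (c : int -> V),
    [/\ uniq s, forall i, G i (c i) & x = \sum_(i <- s) c i].
Proof.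
case=> L; elim: L x => [|[i y] L IH] x GL ->.
  by exists [::], (fun=> 0); split => //; rewrite !big_nil.
have [|s [c [us Gc Ec]]] := IH _ _ erefl.
  by move=> p pL; apply: GL; rewrite in_cons pL orbT.
have Gy : G i y by apply: (GL (i, y)); rewrite mem_head.
rewrite big_cons /= Ec; pose c0 j := if j \in s then c j else 0.
exists (undup (i :: s)), (fun j => c0 j + if j == i then y else 0).
split=> [|j|]; first exact: undup_uniq.
  apply: gradingD_of; first by rewrite /c0; case: ifP.
  by case: eqP => [->|].
have Es : \sum_(j <- s) c j = \sum_(j <- undup (i :: s)) c0 j.
  have -> : \sum_(j <- s) c j = \sum_(j <- s) c0 j.
    by rewrite !big_seq; apply: eq_bigr => j js; rewrite /c0 js.
  rewrite /= undup_id //; case: ifP => // iNs.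
  by rewrite big_cons [c0 i]/c0 iNs add0r.
rewrite big_split -Es addrC; congr (_ + _).
rewrite (bigD1_seq i) ?undup_uniq ?mem_undup ?mem_head //= eqxx.
by rewrite big1 ?addr0 // => j /negPf ->.
Qed.

Lemma grading_span_mem x (s : seq int) (c : int -> V) :
  (forall i, G i (c i)) -> x = \sum_(i <- s) c i ->
  exists2 L : seq (int * V), (forall p, p \in L -> G p.1 p.2) &
     x = \sum_(p <- L) p.2.
Proof.
move=> Gc ->; exists [seq (i, c i) | i <- s]; last by rewrite big_map.
by move=> p /mapP[i _ ->].
Qed.

End GradingLemmas.

Section GradedModules.
Variable B : grRing.
Implicit Types M N P : grModule B.

Definition gr_hom M N (f : M -> N) : Prop :=
  linear f /\ forall i x, gm_deg i x -> gm_deg i (f x).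

Definition gr_iso M N : Prop :=
  exists (f : M -> N) (g : N -> M),
    [/\ gr_hom f, gr_hom g, cancel f g & cancel g f].

Definition gr_fg M : Prop :=
  exists (n : nat) (g : 'I_n -> M), forall x : M,
    exists b : 'I_n -> B^c, x = \sum_i b i *: g i.

Definition gr_surj M N (f : M -> N) : Prop := forall y, exists x, f x = y.

(* Projectivity in the category of graded modules and degree-preserving
   homomorphisms. *)
Definition gr_projective P : Prop :=
  forall (M N : grModule B) (g : M -> N) (f : P -> N),
    gr_hom g -> gr_surj g -> gr_hom f ->
    exists2 h : P -> M, gr_hom h & forall x, g (h x) = f x.

Lemma linear_map0 M N (f : M -> N) : linear f -> f 0 = 0.
Proof.
move=> lf; have := lf 1 0 0; rewrite !scale1r addr0.
by rewrite -[X in X = _]addr0 => /addrI.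
Qed.

Lemma linear_mapD M N (f : M -> N) : linear f -> {morph f : x y / x + y}.
Proof. by move=> lf x y; have := lf 1 x y; rewrite !scale1r. Qed.

Lemma linear_mapZ M N (f : M -> N) :
  linear f -> forall (b : B^c) x, f (b *: x) = b *: f x.
Proof.
by move=> lf b x; have := lf b x 0; rewrite (linear_map0 lf) !addr0.
Qed.

Lemma gr_hom_comp M N P (f : M -> N) (g : N -> P) :
  gr_hom f -> gr_hom g -> gr_hom (g \o f).
Proof.
move=> [lf df] [lg dg]; split=> [a x y|i x /df/dg //].
by rewrite /= lf lg.
Qed.

Lemma gr_hom_id M : gr_hom (@id M).
Proof. by split. Qed.

Section DirectSum.
Variables M N : grModule B.

Definition gm_sum_deg (i : int) (x : M * N) : Prop :=
  gm_deg i x.1 /\ gm_deg i x.2.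

Lemma sum_pair (I : Type) (s : seq I) (c : I -> M * N) :
  \sum_(i <- s) c i = (\sum_(i <- s) (c i).1, \sum_(i <- s) (c i).2).
Proof.
elim: s => [|i s IH]; first by rewrite !big_nil.
by rewrite !big_cons IH; case: (c i).
Qed.

Lemma add_pairE (a a' : M) (b b' : N) :
  ((a, b) : M * N) + (a', b') = (a + a', b + b').
Proof. by []. Qed.

Lemma gm_sum_grading : @is_grading (M * N)%type gm_sum_deg.
Proof.
have [M0 MB Ms Mf] := gm_grading M; have [N0 NB Ns Nf] := gm_grading N.
have D0 i : gm_sum_deg i 0 by split; [apply: M0|apply: N0].
have DB i x y : gm_sum_deg i x -> gm_sum_deg i y -> gm_sum_deg i (x - y).
  by move=> [x1 x2] [y1 y2]; split; [apply: MB|apply: NB].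
split=> //.
  move=> [x y]; apply: grading_span_of => //.
  have [s [c [_ Gc ->]]] := Ms x; have [t [d [_ Gd ->]]] := Ns y.
  exists ([seq (i, (c i, 0)) | i <- s] ++ [seq (i, (0, d i)) | i <- t]).
    move=> p; rewrite mem_cat => /orP[] /mapP[i _ ->] /=.
      by split => //=; apply: N0.
    by split => //=; apply: M0.
  by rewrite big_cat !big_map /= !sum_pair /= !big1_eq add_pairE addr0 add0r.
move=> s c us Gc; rewrite sum_pair => -[E1 E2] i si.
rewrite [c i]surjective_pairing.
rewrite (Mf s (fun i => (c i).1) us) //; last by move=> j; case: (Gc j).
by rewrite (Nf s (fun i => (c i).2) us) // => j; case: (Gc j).
Qed.

Lemma gm_sum_degZ i j (x : (M * N)%type) (b : B) :
  gm_sum_deg i x -> gr_deg j b -> gm_sum_deg (i + j) ((b : B^c) *: x).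
Proof. by move=> [x1 x2] bj; split; apply: gm_degZ. Qed.

Definition gm_sum : grModule B := GrModule gm_sum_grading gm_sum_degZ.

Lemma gm_sum_fg : gr_fg M -> gr_fg N -> gr_fg gm_sum.
Proof.
move=> [m [g gP]] [n [h hP]].
exists (m + n)%N, (fun i => match split i with
  | inl j => (g j, 0) : gm_sum | inr k => (0, h k) end) => -[x y].
have [a Ea] := gP x; have [b Eb] := hP y.
exists (fun i => match split i with inl j => a j | inr k => b k end).
rewrite big_split_ord /= Ea Eb.
under eq_bigr do rewrite (unsplitK (inl _)) /=.
under [X in _ + X]eq_bigr do rewrite (unsplitK (inr _)) /=.
rewrite !sum_pair /=.
under [X in _ = (_, X) + _]eq_bigr do rewrite scaler0.
under [X in _ = _ + (X, _)]eq_bigr do rewrite scaler0.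
by rewrite !big1_eq add_pairE addr0 add0r.
Qed.

Lemma gm_sum_projective :
  gr_projective M -> gr_projective N -> gr_projective gm_sum.
Proof.
move=> pM pN X Y g f gh gs [lf df].
have [M0 _ _ _] := gm_grading M; have [N0 _ _ _] := gm_grading N.
have [|h [lh dh] hE] := pM X Y g (fun x => f (x, 0)) gh gs.
- split=> [a x y|i x xi]; last by apply: df; split => //=; apply: N0.
  by rewrite -lf; congr f; congr (_, _); rewrite /= scaler0 addr0.
have [|k [lk dk] kE] := pN X Y g (fun x => f (0, x)) gh gs.
- split=> [a x y|i x xi]; last by apply: df; split => //=; apply: M0.
  by rewrite -lf; congr f; congr (_, _); rewrite /= scaler0 addr0.
have [X0 XB _ _] := gm_grading X.
exists (fun x => h x.1 + k x.2).
  split=> [a x y|i x [xi1 xi2]] /=.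
    by rewrite lh lk scalerDr addrACA.
  by apply: gradingD_of => //; [apply: dh|apply: dk].
move=> [x y] /=; case: (gh) => lg _; rewrite (linear_mapD lg) hE kE.
by rewrite -(linear_mapD lf); congr f; rewrite /= add_pairE addr0 add0r.
Qed.

End DirectSum.

Definition gm_zero_deg (i : int) (x : 'rV[B^c]_0) : Prop := True.

Lemma gm_zero_grading : is_grading gm_zero_deg.
Proof.
split=> // [x|s c _ _ _ i _]; last by apply/rowP => -[].
by exists [::], (fun=> 0); split => //; apply/rowP => -[].
Qed.

Definition gm_zero : grModule B :=
  @GrModule B 'rV[B^c]_0 gm_zero_deg gm_zero_grading
    (fun _ _ _ _ _ _ => I).

Lemma gm_zero_eq (x y : gm_zero) : x = y.
Proof. by apply/rowP => -[]. Qed.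

Lemma gm_zero_fg : gr_fg gm_zero.
Proof.
by exists 0%N, (fun=> 0) => x; exists (fun=> 0); apply: gm_zero_eq.
Qed.

Lemma gm_zero_projective : gr_projective gm_zero.
Proof.
move=> M N g f [lg _] _ [lf _]; have [M0 _ _ _] := gm_grading M.
exists (fun=> 0); first by split=> [a x y|i x _]; rewrite ?scaler0 ?addr0.
by move=> x; rewrite linear_map0 // (gm_zero_eq x 0) linear_map0.
Qed.

Section Shift.
Variables (k : int) (M : grModule B).

Definition gm_shift_deg (j : int) (x : M) : Prop := gm_deg (k + j) x.

Lemma gm_shift_grading : is_grading gm_shift_deg.
Proof.
have [M0 MB Ms Mf] := gm_grading M.
split=> [i|i x y|x|s c us Gc E i si].
- exact: M0.
- exact: MB.
- have [s [c [us Gc ->]]] := Ms x.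
  exists [seq i - k | i <- s], (fun i => c (k + i)); split.
  + by rewrite map_inj_uniq // => i j /addIr.
  + by move=> i; apply: Gc.
  + by rewrite big_map; apply: eq_bigr => i _; rewrite addrC subrK.
have <- := Mf [seq k + i | i <- s] (fun i => c (i - k)) _ _ _ (k + i).
- by rewrite addrC addKr.
- by rewrite map_inj_uniq // => a b /addrI.
- by move=> j; have := Gc (j - k); rewrite /gm_shift_deg addrC subrK.
- by rewrite big_map -[RHS]E; apply: eq_bigr => j _; rewrite addrC addKr.
- exact: map_f.
Qed.

Lemma gm_shift_degZ i j (x : M) (b : B) :
  gm_shift_deg i x -> gr_deg j b -> gm_shift_deg (i + j) ((b : B^c) *: x).
Proof. by rewrite /gm_shift_deg addrA; apply: gm_degZ. Qed.

Definition gm_shift : grModule B := GrModule gm_shift_grading gm_shift_degZ.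

Lemma gm_shift_fg : gr_fg M -> gr_fg gm_shift.
Proof. by []. Qed.

End Shift.

Lemma gm_shift_hom k M N (f : M -> N) :
  gr_hom f -> gr_hom (f : gm_shift k M -> gm_shift k N).
Proof. by move=> [lf df]; split=> // i x; apply: df. Qed.

Lemma gm_shift_projective k M : gr_projective M -> gr_projective (gm_shift k M).
Proof.
move=> pM X Y g f gh gs [lf df].
have [|h [lh dh] hE] :=
    pM (gm_shift (- k) X) (gm_shift (- k) Y) g f (gm_shift_hom (- k) gh) gs.
- split=> // i x xi; apply: df.
  by rewrite /= /gm_shift_deg addrA subrr add0r.
exists h => //; split=> // i x /dh /=.
by rewrite /gm_shift_deg addKr.
Qed.

Record fgp := Fgp {
  fgp_mod :> grModule B;
  fgp_fg : gr_fg fgp_mod;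
  fgp_projective : gr_projective fgp_mod
}.

Definition fgp_iso (P Q : fgp) : Prop := gr_iso P Q.

Lemma fgp_iso_eqv : is_equivalence fgp_iso.
Proof.
split=> [P|P Q [f [g [fh gh fK gK]]]|P Q X [f [g [fh gh fK gK]]]].
- by exists id, id; split => //; apply: gr_hom_id.
- by exists g, f; split.
move=> [f' [g' [fh' gh' fK' gK']]].
exists (f' \o f), (g \o g').
by split; [exact: gr_hom_comp|exact: gr_hom_comp|apply: can_comp|apply: can_comp].
Qed.

Definition fgp_sum (P Q : fgp) : fgp :=
  Fgp (gm_sum_fg (fgp_fg P) (fgp_fg Q))
      (gm_sum_projective (@fgp_projective P) (@fgp_projective Q)).

Definition fgp_zero : fgp := Fgp gm_zero_fg gm_zero_projective.

Definition fgp_shift (k : int) (P : fgp) : fgp :=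
  Fgp (gm_shift_fg k (fgp_fg P))
      (@gm_shift_projective k P (@fgp_projective P)).

Lemma fgp_sum_iso (P P' Q Q' : fgp) :
  fgp_iso P P' -> fgp_iso Q Q' -> fgp_iso (fgp_sum P Q) (fgp_sum P' Q').
Proof.
move=> [f [g [[lf df] [lg dg] fK gK]]] [f' [g' [[lf' df'] [lg' dg'] fK' gK']]].
exists (fun x => (f x.1, f' x.2)), (fun x => (g x.1, g' x.2)); split.
- by split=> [a x y|i x [/df ? /df' ?]] //=; rewrite lf lf'.
- by split=> [a x y|i x [/dg ? /dg' ?]] //=; rewrite lg lg'.
- by move=> [x y] /=; rewrite fK fK'.
- by move=> [x y] /=; rewrite gK gK'.
Qed.

Lemma fgp_sumA (P Q X : fgp) :
  fgp_iso (fgp_sum P (fgp_sum Q X)) (fgp_sum (fgp_sum P Q) X).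
Proof.
exists (fun x => ((x.1, x.2.1), x.2.2)), (fun x => (x.1.1, (x.1.2, x.2))).
split; [| |by case=> ? [? ?]|by case=> [[? ?] ?]].
- by split=> // i x [? [? ?]].
- by split=> // i x [[? ?] ?].
Qed.

Lemma fgp_sumC (P Q : fgp) : fgp_iso (fgp_sum P Q) (fgp_sum Q P).
Proof.
exists (fun x => (x.2, x.1)), (fun x => (x.2, x.1)).
by split; [| |by case|by case]; split=> // i x [? ?].
Qed.

Lemma fgp_sum0 (P : fgp) : fgp_iso (fgp_sum fgp_zero P) P.
Proof.
exists (fun x => x.2), (fun x => (0, x)); split=> //.
- by split=> // i x [].
- by split=> [a x y|i x xi]; [congr (_, _); apply: gm_zero_eq|split].
- by move=> [x y]; congr (_, _); apply: gm_zero_eq.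
Qed.

Lemma fgp_shift_iso k (P Q : fgp) :
  fgp_iso P Q -> fgp_iso (fgp_shift k P) (fgp_shift k Q).
Proof.
move=> [f [g [fh gh fK gK]]].
by exists f, g; split=> //; apply: gm_shift_hom.
Qed.

Lemma fgp_shift_sum k (P Q : fgp) :
  fgp_iso (fgp_shift k (fgp_sum P Q)) (fgp_sum (fgp_shift k P) (fgp_shift k Q)).
Proof. by exists id, id; split. Qed.

Lemma fgp_shift0 (P : fgp) : fgp_iso (fgp_shift 0 P) P.
Proof.
by exists id, id; split=> //; split=> // i x; rewrite /= /gm_shift_deg add0r.
Qed.

Lemma fgp_shift_shift k l (P : fgp) :
  fgp_iso (fgp_shift k (fgp_shift l P)) (fgp_shift (k + l) P).
Proof.
by exists id, id; split=> //; split=> // i x;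
  rewrite /= /gm_shift_deg /= /gm_shift_deg [k + l]addrC addrA.
Qed.

Definition iso_class : Type := quot fgp_iso.
Definition iso_class_sum := quot_map2 (R := fgp_iso) fgp_sum.
Definition iso_class_shift (k : int) := quot_map (R := fgp_iso) (fgp_shift k).

Lemma iso_class_sumE (P Q : fgp) :
  iso_class_sum (quot_class fgp_iso P) (quot_class fgp_iso Q)
  = quot_class fgp_iso (fgp_sum P Q).
Proof.
by apply: quot_map2E => [|X X' Y Y']; [apply: fgp_iso_eqv|apply: fgp_sum_iso].
Qed.

Lemma iso_class_shiftE k (P : fgp) :
  iso_class_shift k (quot_class fgp_iso P)
  = quot_class fgp_iso (fgp_shift k P).
Proof.
by apply: quot_mapE => [|X Y]; [apply: fgp_iso_eqv|apply: fgp_shift_iso].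
Qed.

Lemma iso_class_sumA : associative iso_class_sum.
Proof.
move=> x y z; have [P ->] := quot_classS x; have [Q ->] := quot_classS y.
have [X ->] := quot_classS z; rewrite !iso_class_sumE.
by apply/(quot_classP fgp_iso_eqv); apply: fgp_sumA.
Qed.

Lemma iso_class_sumC : commutative iso_class_sum.
Proof.
move=> x y; have [P ->] := quot_classS x; have [Q ->] := quot_classS y.
rewrite !iso_class_sumE.
by apply/(quot_classP fgp_iso_eqv); apply: fgp_sumC.
Qed.

Lemma iso_class_sum0 :
  left_id (quot_class fgp_iso fgp_zero) iso_class_sum.
Proof.
move=> x; have [P ->] := quot_classS x; rewrite iso_class_sumE.
by apply/(quot_classP fgp_iso_eqv); apply: fgp_sum0.
Qed.

Definition iso_class_monoid : cMonoid :=
  CMonoid iso_class_sumA iso_class_sumC iso_class_sum0.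

Lemma iso_class_shiftD k :
  {morph (iso_class_shift k : iso_class_monoid -> iso_class_monoid)
    : x y / cm_add x y}.
Proof.
move=> x y; have [P ->] := quot_classS x; have [Q ->] := quot_classS y.
rewrite /= iso_class_sumE !iso_class_shiftE iso_class_sumE.
by apply/(quot_classP fgp_iso_eqv); apply: fgp_shift_sum.
Qed.

Definition K0gr_group : abGroup := group_completion iso_class_monoid.

Definition K0gr_shift (k : int) : K0gr_group -> K0gr_group :=
  gc_map (iso_class_shift k : iso_class_monoid -> iso_class_monoid).

Lemma K0gr_shiftD k : {morph K0gr_shift k : x y / ag_add x y}.
Proof. by move=> x y; apply: gc_map_add; apply: iso_class_shiftD. Qed.

Lemma K0gr_shift0 x : K0gr_shift 0 x = x.
Proof.
have [[a b] ->] := quot_classS x.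
rewrite /K0gr_shift gc_mapE; last exact: iso_class_shiftD.
congr quot_class; rewrite /gc_pair_map /=.
by congr (_, _); [have [P ->] := quot_classS a|have [P ->] := quot_classS b];
  rewrite iso_class_shiftE; apply/(quot_classP fgp_iso_eqv);
  apply: fgp_shift0.
Qed.

Lemma K0gr_shift_shift k l x :
  K0gr_shift k (K0gr_shift l x) = K0gr_shift (k + l) x.
Proof.
have [[a b] ->] := quot_classS x.
rewrite /K0gr_shift !gc_mapE; try exact: iso_class_shiftD.
congr quot_class; rewrite /gc_pair_map /=.
by congr (_, _); [have [P ->] := quot_classS a|have [P ->] := quot_classS b];
  rewrite !iso_class_shiftE; apply/(quot_classP fgp_iso_eqv);
  apply: fgp_shift_shift.
Qed.

Definition K0gr : lModule laurent :=
  laurent_module K0gr_shiftD K0gr_shift0 K0gr_shift_shift.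

Definition K0gr_class (P : fgp) : K0gr :=
  quot_class (@gc_rel iso_class_monoid)
    (quot_class fgp_iso P, quot_class fgp_iso fgp_zero).

Lemma K0gr_scale_class k (P : fgp) :
  lm_scale (<< 1 *g k >> : laurent) (K0gr_class P)
  = K0gr_class (fgp_shift k P).
Proof.
rewrite [LHS]laurent_actU ag_mulz1 /K0gr_class.
rewrite /K0gr_shift gc_mapE; last exact: iso_class_shiftD.
congr quot_class; rewrite /gc_pair_map /= !iso_class_shiftE; congr (_, _).
apply/(quot_classP fgp_iso_eqv).
by exists id, id; split.
Qed.

End GradedModules.

Record digraph := Digraph {
  vertex : finType;
  edge : finType;
  edge_source : edge -> vertex;
  edge_range : edge -> vertex
}.

(* The path algebra is the K-algebra presented by generators and relations,
   built as the terms in the generators modulo the least congruence that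
   contains the axioms of (not necessarily unital) associative K-algebras and
   the defining relations. No unit is adjoined: the unit is the sum of the
   vertices, so that the algebra is zero when E has no vertex. *)
Section PathAlgebra.
Variables (K : fieldType) (E : digraph).

Inductive path_term : Type :=
| PVertex of vertex E
| PEdge of edge E
| PZero
| PAdd of path_term & path_term
| PScale of K & path_term
| PMul of path_term & path_term.

Inductive path_eq : path_term -> path_term -> Prop :=
| peq_refl x : path_eq x x
| peq_sym x y : path_eq x y -> path_eq y x
| peq_trans x y z : path_eq x y -> path_eq y z -> path_eq x z
| peq_add x x' y y' :
    path_eq x x' -> path_eq y y' -> path_eq (PAdd x y) (PAdd x' y')
| peq_scale a x x' : path_eq x x' -> path_eq (PScale a x) (PScale a x')
| peq_mul x x' y y' :
    path_eq x x' -> path_eq y y' -> path_eq (PMul x y) (PMul x' y')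
| peq_addA x y z : path_eq (PAdd x (PAdd y z)) (PAdd (PAdd x y) z)
| peq_addC x y : path_eq (PAdd x y) (PAdd y x)
| peq_add0 x : path_eq (PAdd PZero x) x
| peq_addN x : path_eq (PAdd (PScale (-1) x) x) PZero
| peq_scaleA a b x : path_eq (PScale a (PScale b x)) (PScale (a * b) x)
| peq_scale1 x : path_eq (PScale 1 x) x
| peq_scaleDr a x y :
    path_eq (PScale a (PAdd x y)) (PAdd (PScale a x) (PScale a y))
| peq_scaleDl a b x :
    path_eq (PScale (a + b) x) (PAdd (PScale a x) (PScale b x))
| peq_mulA x y z : path_eq (PMul x (PMul y z)) (PMul (PMul x y) z)
| peq_mulDl x y z : path_eq (PMul (PAdd x y) z) (PAdd (PMul x z) (PMul y z))
| peq_mulDr x y z : path_eq (PMul x (PAdd y z)) (PAdd (PMul x y) (PMul x z))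
| peq_scaleAl a x y : path_eq (PScale a (PMul x y)) (PMul (PScale a x) y)
| peq_scaleAr a x y : path_eq (PScale a (PMul x y)) (PMul x (PScale a y))
| peq_vertex v w :
    path_eq (PMul (PVertex v) (PVertex w))
            (if v == w then PVertex v else PZero)
| peq_source e : path_eq (PMul (PVertex (edge_source e)) (PEdge e)) (PEdge e)
| peq_range e : path_eq (PMul (PEdge e) (PVertex (edge_range e))) (PEdge e).

HB.instance Definition _ := gen_eqMixin path_term.
HB.instance Definition _ := gen_choiceMixin path_term.

Definition path_eqb : rel path_term := fun x y => `[< path_eq x y >].

Lemma path_eqb_refl : reflexive path_eqb.
Proof. by move=> x; apply/asboolP; apply: peq_refl. Qed.

Lemma path_eqb_sym : symmetric path_eqb.
Proof. by move=> x y; apply/asboolP/asboolP; apply: peq_sym. Qed.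

Lemma path_eqb_trans : transitive path_eqb.
Proof.
by move=> y x z /asboolP xy /asboolP yz; apply/asboolP; apply: peq_trans yz.
Qed.

Canonical path_eqb_equiv :=
  EquivRel path_eqb path_eqb_refl path_eqb_sym path_eqb_trans.

Definition path_alg : Type := {eq_quot path_eqb}.
HB.instance Definition _ := Choice.on path_alg.
HB.instance Definition _ := EqQuotient.on path_alg.

Definition path_pi (x : path_term) : path_alg := \pi_path_alg x.

Lemma path_piP x y : path_pi x = path_pi y <-> path_eq x y.
Proof.
by split=> [/eqmodP/asboolP|xy]; last by apply/eqmodP/asboolP.
Qed.

Lemma path_repr_pi x : path_eq (repr (path_pi x)) x.
Proof. by apply/path_piP; rewrite /path_pi reprK. Qed.

Lemma path_piS (x : path_alg) : exists t, x = path_pi t.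
Proof. by exists (repr x); rewrite /path_pi reprK. Qed.

Definition path_zero : path_alg := path_pi PZero.
Definition path_add (x y : path_alg) : path_alg :=
  path_pi (PAdd (repr x) (repr y)).
Definition path_scale (a : K) (x : path_alg) : path_alg :=
  path_pi (PScale a (repr x)).
Definition path_opp (x : path_alg) : path_alg := path_scale (-1) x.
Definition path_mul (x y : path_alg) : path_alg :=
  path_pi (PMul (repr x) (repr y)).

Lemma path_addE x y : path_add (path_pi x) (path_pi y) = path_pi (PAdd x y).
Proof. by apply/path_piP; apply: peq_add; apply: path_repr_pi. Qed.

Lemma path_scaleE a x : path_scale a (path_pi x) = path_pi (PScale a x).
Proof. by apply/path_piP; apply: peq_scale; apply: path_repr_pi. Qed.

Lemma path_mulE x y : path_mul (path_pi x) (path_pi y) = path_pi (PMul x y).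
Proof. by apply/path_piP; apply: peq_mul; apply: path_repr_pi. Qed.

Lemma path_addA : associative path_add.
Proof.
move=> x y z; have [s ->] := path_piS x; have [t ->] := path_piS y.
by have [u ->] := path_piS z; rewrite !path_addE; apply/path_piP; constructor.
Qed.

Lemma path_addC : commutative path_add.
Proof.
move=> x y; have [s ->] := path_piS x; have [t ->] := path_piS y.
by rewrite !path_addE; apply/path_piP; apply: peq_addC.
Qed.

Lemma path_add0 : left_id path_zero path_add.
Proof.
move=> x; have [s ->] := path_piS x.
by rewrite path_addE; apply/path_piP; apply: peq_add0.
Qed.

Lemma path_addN : left_inverse path_zero path_opp path_add.
Proof.
move=> x; have [s ->] := path_piS x.
by rewrite /path_opp path_scaleE path_addE; apply/path_piP; apply: peq_addN.
Qed.

HB.instance Definition _ := GRing.isZmodule.Build path_alg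
  path_addA path_addC path_add0 path_addN.

Lemma path_scaleA a b x : path_scale a (path_scale b x) = path_scale (a * b) x.
Proof.
have [s ->] := path_piS x.
by rewrite !path_scaleE; apply/path_piP; apply: peq_scaleA.
Qed.

Lemma path_scale1 : left_id 1 path_scale.
Proof.
move=> x; have [s ->] := path_piS x.
by rewrite path_scaleE; apply/path_piP; apply: peq_scale1.
Qed.

Lemma path_scaleDr : right_distributive path_scale path_add.
Proof.
move=> a x y; have [s ->] := path_piS x; have [t ->] := path_piS y.
rewrite path_addE !path_scaleE path_addE.
by apply/path_piP; apply: peq_scaleDr.
Qed.

Lemma path_scaleDl x :
  {morph path_scale^~ x : a b / a + b >-> path_add a b}.
Proof.
move=> a b; have [s ->] := path_piS x.
by rewrite !path_scaleE path_addE; apply/path_piP; apply: peq_scaleDl.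
Qed.

HB.instance Definition _ := GRing.Zmodule_isLmodule.Build K path_alg
  path_scaleA path_scale1 path_scaleDr path_scaleDl.

Definition pvertex (v : vertex E) : path_alg := path_pi (PVertex v).
Definition pedge (e : edge E) : path_alg := path_pi (PEdge e).

Lemma path_piD x y : path_pi (PAdd x y) = path_pi x + path_pi y.
Proof. by rewrite -path_addE. Qed.

Lemma path_piZ a x : path_pi (PScale a x) = a *: path_pi x.
Proof. by rewrite -path_scaleE. Qed.

Lemma path_mulA : associative path_mul.
Proof.
move=> x y z; have [s ->] := path_piS x; have [t ->] := path_piS y.
have [u ->] := path_piS z; rewrite !path_mulE.
by apply/path_piP; apply: peq_mulA.
Qed.

Lemma path_mulDl : left_distributive path_mul +%R.
Proof.
move=> x y z; have [s ->] := path_piS x; have [t ->] := path_piS y.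
have [u ->] := path_piS z; rewrite -path_piD !path_mulE -path_piD.
by apply/path_piP; apply: peq_mulDl.
Qed.

Lemma path_mulDr : right_distributive path_mul +%R.
Proof.
move=> x y z; have [s ->] := path_piS x; have [t ->] := path_piS y.
have [u ->] := path_piS z; rewrite -path_piD !path_mulE -path_piD.
by apply/path_piP; apply: peq_mulDr.
Qed.

Lemma path_scaleAl (a : K) x y : a *: path_mul x y = path_mul (a *: x) y.
Proof.
have [s ->] := path_piS x; have [t ->] := path_piS y.
rewrite -path_piZ !path_mulE -path_piZ.
by apply/path_piP; apply: peq_scaleAl.
Qed.

Lemma path_scaleAr (a : K) x y : a *: path_mul x y = path_mul x (a *: y).
Proof.
have [s ->] := path_piS x; have [t ->] := path_piS y.
rewrite -path_piZ !path_mulE -path_piZ.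
by apply/path_piP; apply: peq_scaleAr.
Qed.

Lemma path_mul_vertex v w :
  path_mul (pvertex v) (pvertex w) = if v == w then pvertex v else 0.
Proof.
rewrite path_mulE (_ : (if _ then _ else _)
  = path_pi (if v == w then PVertex v else PZero)); last by case: eqP.
by apply/path_piP; apply: peq_vertex.
Qed.

Lemma path_mul_source e :
  path_mul (pvertex (edge_source e)) (pedge e) = pedge e.
Proof. by rewrite path_mulE; apply/path_piP; apply: peq_source. Qed.

Lemma path_mul_range e : path_mul (pedge e) (pvertex (edge_range e)) = pedge e.
Proof. by rewrite path_mulE; apply/path_piP; apply: peq_range. Qed.

Lemma path_alg_ind (P : path_alg -> Prop) :
  (forall v, P (pvertex v)) -> (forall e, P (pedge e)) -> P 0 ->
  (forall x y, P x -> P y -> P (x + y)) ->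
  (forall (a : K) x, P x -> P (a *: x)) ->
  (forall x y, P x -> P y -> P (path_mul x y)) -> forall x, P x.
Proof.
move=> Pv Pe P0 PD PZ PM x; have [t ->] := path_piS x.
elim: t => // [s Ps t Pt|a t Pt|s Ps t Pt]; rewrite ?path_piD ?path_piZ.
- exact: PD.
- exact: PZ.
- by rewrite -path_mulE; apply: PM.
Qed.

Lemma path_mul0l : left_zero 0 path_mul.
Proof.
by move=> x; apply: (addrI (path_mul 0 x)); rewrite -path_mulDl !addr0.
Qed.

Lemma path_mul0r : right_zero 0 path_mul.
Proof.
by move=> x; apply: (addrI (path_mul x 0)); rewrite -path_mulDr !addr0.
Qed.

Definition path_one : path_alg := \sum_(v : vertex E) pvertex v.

Lemma path_mul_suml (I : Type) (s : seq I) (P : pred I) (F : I -> path_alg) x :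
  path_mul (\sum_(i <- s | P i) F i) x = \sum_(i <- s | P i) path_mul (F i) x.
Proof.
apply: (big_morph (path_mul^~ x)); last exact: path_mul0l.
by move=> y z; rewrite path_mulDl.
Qed.

Lemma path_mul_sumr (I : Type) (s : seq I) (P : pred I) (F : I -> path_alg) x :
  path_mul x (\sum_(i <- s | P i) F i) = \sum_(i <- s | P i) path_mul x (F i).
Proof.
apply: (big_morph (path_mul x)); last exact: path_mul0r.
by move=> y z; rewrite path_mulDr.
Qed.

Lemma path_mul1l : left_id path_one path_mul.
Proof.
have vP v : path_mul path_one (pvertex v) = pvertex v.
  rewrite path_mul_suml (bigD1 v) //= path_mul_vertex eqxx big1 ?addr0 //.
  by move=> w /negPf wv; rewrite path_mul_vertex wv.
elim/path_alg_ind => [//|e||x y Ex Ey|a x Ex|x y Ex Ey].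
- by rewrite -[X in path_mul _ X]path_mul_source path_mulA vP path_mul_source.
- exact: path_mul0r.
- by rewrite path_mulDr Ex Ey.
- by rewrite -path_scaleAr Ex.
- by rewrite path_mulA Ex.
Qed.

Lemma path_mul1r : right_id path_one path_mul.
Proof.
have vP v : path_mul (pvertex v) path_one = pvertex v.
  rewrite path_mul_sumr (bigD1 v) //= path_mul_vertex eqxx big1 ?addr0 //.
  by move=> w /negPf wv; rewrite path_mul_vertex eq_sym wv.
elim/path_alg_ind => [//|e||x y Ex Ey|a x Ex|x y Ex Ey].
- by rewrite -[X in path_mul X _]path_mul_range -path_mulA vP path_mul_range.
- exact: path_mul0l.
- by rewrite path_mulDl Ex Ey.
- by rewrite -path_scaleAl Ex.
- by rewrite -path_mulA Ey.
Qed.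

HB.instance Definition _ := GRing.Zmodule_isPzRing.Build path_alg
  path_mulA path_mul1l path_mul1r path_mulDl path_mulDr.

(* The least multiplicative family of K-subspaces for which the vertices have
   degree 0 and the edges have degree 1. *)
Inductive path_deg : int -> path_alg -> Prop :=
| pdeg_vertex v : path_deg 0 (pvertex v)
| pdeg_edge e : path_deg 1 (pedge e)
| pdeg_zero i : path_deg i 0
| pdeg_add i x y : path_deg i x -> path_deg i y -> path_deg i (x + y)
| pdeg_scale i (a : K) x : path_deg i x -> path_deg i (a *: x)
| pdeg_mul i j x y :
    path_deg i x -> path_deg j y -> path_deg (i + j) (x * y).

Lemma path_deg1 : path_deg 0 1.
Proof.
rewrite -[1]/path_one /path_one; elim/big_rec: _ => [|v x _ xP].
  exact: pdeg_zero.
by apply: pdeg_add => //; apply: pdeg_vertex.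
Qed.

Lemma path_deg_sub i x y : path_deg i x -> path_deg i y -> path_deg i (x - y).
Proof.
by move=> xi yi; apply: pdeg_add => //; rewrite -scaleN1r; apply: pdeg_scale.
Qed.

Definition cauchy_mul (f g : nat -> path_alg) (n : nat) : path_alg :=
  \sum_(i < n.+1) f i * g (n - i)%N.

Lemma cauchy_mulA f g h :
  cauchy_mul f (cauchy_mul g h) =1 cauchy_mul (cauchy_mul f g) h.
Proof.
move=> n; rewrite /cauchy_mul.
pose F i j := f i * (g j * h (n - i - j)%N).
transitivity (\sum_(i < n.+1) \sum_(j < n.+1 | (i + j <= n)%N) F i j).
  apply: eq_bigr => i _; rewrite mulr_sumr.
  rewrite (big_ord_widen_cond n.+1 predT (F i)); last first.
    by rewrite ltnS leq_subr.
  by apply: eq_bigl => j; rewrite /= ltnS leq_subRL // -ltnS.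
transitivity (\sum_(k < n.+1) \sum_(i < n.+1 | (i <= k)%N)
   f i * (g (k - i)%N * h (n - k)%N)); last first.
  apply: eq_bigr => k _; rewrite mulr_suml.
  rewrite (big_ord_widen_cond n.+1 predT
     (fun i => f i * g (k - i)%N * h (n - k)%N)) //.
  by apply: eq_bigr => i _; rewrite mulrA.
rewrite [RHS](exchange_big_dep predT) //=; apply: eq_bigr => i _.
transitivity (\sum_(0 <= j < n.+1 | (i + j <= n)%N) F i j).
  by rewrite big_mkord.
transitivity (\sum_(0 <= k < n.+1 | (i <= k)%N)
   f i * (g (k - i)%N * h (n - k)%N)); last by rewrite big_mkord.
have lein : (i <= n.+1)%N by apply: ltnW.
transitivity (\sum_(0 <= j < n.+1 - i) F i j).
  rewrite (big_cat_nat _ (n := (n.+1 - i)%N)) ?leq_subr //=.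
  rewrite [X in _ + X]big_nat_cond [X in _ + X]big1 ?addr0; last first.
    by move=> j; rewrite leq_subLR => /andP[/andP[lt _]]; rewrite leqNgt lt.
  rewrite big_nat_cond [RHS]big_nat_cond; apply: eq_bigl => j.
  by rewrite ltn_subRL ltnS andbb andbT.
transitivity (\sum_(i <= k < n.+1) f i * (g (k - i)%N * h (n - k)%N)).
  rewrite -[X in _ = \sum_(X <= _ < _) _]add0n big_addn; apply: eq_bigr => j _.
  by rewrite /F addnK [(j + i)%N]addnC subnDA.
rewrite [RHS](big_cat_nat _ (n := i)) //=.
rewrite [X in _ = X + _]big_nat_cond [X in _ = X + _]big1 ?add0r; last first.
  by move=> j /andP[/andP[_ ji]]; rewrite leqNgt ji.
rewrite big_nat_cond [RHS]big_nat_cond; apply: eq_bigl => j.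
by case: (i <= j)%N; rewrite ?andbF ?andbT.
Qed.

(* [path_comp t n] is the component of degree n of the class of t. *)
Fixpoint path_comp (t : path_term) : nat -> path_alg :=
  match t with
  | PVertex v => fun n => if n == 0%N then pvertex v else 0
  | PEdge e => fun n => if n == 1%N then pedge e else 0
  | PZero => fun=> 0
  | PAdd s t => fun n => path_comp s n + path_comp t n
  | PScale a t => fun n => a *: path_comp t n
  | PMul s t => cauchy_mul (path_comp s) (path_comp t)
  end.

Lemma path_comp_eq s t : path_eq s t -> path_comp s =1 path_comp t.
Proof.
elim=> //=.
- by move=> x y _ IH n.
- by move=> x y z _ IH _ IH' n; rewrite IH.
- by move=> x x' y y' _ IH _ IH' n; rewrite IH IH'.
- by move=> a x x' _ IH n; rewrite IH.
- move=> x x' y y' _ IH _ IH' n; apply: eq_bigr => i _.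
  by rewrite IH IH'.
- by move=> x y z n; rewrite addrA.
- by move=> x y n; rewrite addrC.
- by move=> x n; rewrite add0r.
- by move=> x n; rewrite scaleN1r addNr.
- by move=> a b x n; rewrite scalerA.
- by move=> x n; rewrite scale1r.
- by move=> a x y n; rewrite scalerDr.
- by move=> a b x n; rewrite scalerDl.
- by move=> x y z n; apply: cauchy_mulA.
- move=> x y z n; rewrite /cauchy_mul -big_split.
  by apply: eq_bigr => i _; rewrite mulrDl.
- move=> x y z n; rewrite /cauchy_mul -big_split.
  by apply: eq_bigr => i _; rewrite mulrDr.
- move=> a x y n; rewrite /cauchy_mul scaler_sumr.
  by apply: eq_bigr => i _; apply: path_scaleAl.
- move=> a x y n; rewrite /cauchy_mul scaler_sumr.
  by apply: eq_bigr => i _; apply: path_scaleAr.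
- move=> v w n; rewrite /cauchy_mul big_ord_recl /= subn0 big1 ?addr0.
    case: n => [|n] /=; last by rewrite mulr0; case: eqP.
    by rewrite [_ * _]path_mul_vertex; case: eqP.
  by move=> i _; rewrite /= mul0r.
- move=> e n; rewrite /cauchy_mul big_ord_recl /= subn0 big1 ?addr0.
    by case: eqP => _; [apply: path_mul_source|rewrite mulr0].
  by move=> i _; rewrite /= mul0r.
- move=> e n; rewrite /cauchy_mul big_ord_recr /= subnn.
  rewrite big1 ?add0r; last first.
    by move=> [i /= lin] _; rewrite subn_eq0 leqNgt lin mulr0.
  by case: eqP => _; [apply: path_mul_range|rewrite mul0r].
Qed.

Definition path_component (n : nat) (x : path_alg) : path_alg :=
  path_comp (repr x) n.

Lemma path_component_pi n t : path_component n (path_pi t) = path_comp t n.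
Proof. by apply: path_comp_eq; apply: path_repr_pi. Qed.

Lemma path_component0 n : path_component n 0 = 0.
Proof. by rewrite -[0]/path_zero path_component_pi. Qed.

Lemma path_componentD n : {morph path_component n : x y / x + y}.
Proof.
move=> x y; have [s ->] := path_piS x; have [t ->] := path_piS y.
by rewrite -path_piD !path_component_pi.
Qed.

Lemma path_componentZ n (a : K) x :
  path_component n (a *: x) = a *: path_component n x.
Proof.
by have [s ->] := path_piS x; rewrite -path_piZ !path_component_pi.
Qed.

Lemma path_componentM n x y : path_component n (x * y)
  = \sum_(i < n.+1) path_component i x * path_component (n - i) y.
Proof.
have [s ->] := path_piS x; have [t ->] := path_piS y.
rewrite [_ * _]path_mulE path_component_pi; apply: eq_bigr => i _.
by rewrite !path_component_pi.
Qed.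

Lemma path_deg_lt0 i x : path_deg i x -> (i < 0)%R -> x = 0.
Proof.
elim=> //= {i x} [i x y _ IHx _ IHy i0|i a x _ IH i0|i j x y _ IHx _ IHy ij0].
- by rewrite IHx // IHy // addr0.
- by rewrite IH // scaler0.
- have [/IHx ->|i0] := ltP i 0; first by rewrite mul0r.
  by rewrite IHy ?mulr0 // (le_lt_trans _ ij0) // lerDr.
Qed.

Lemma path_component_deg i x : path_deg i x -> forall n : nat,
  path_component n x = if i == n%:Z then x else 0.
Proof.
elim=> {i x} [v|e|i|i x y _ IHx _ IHy|i a x _ IH|i j x y xi IHx yj IHy] n.
- by rewrite path_component_pi /= eqz_nat eq_sym.
- by rewrite path_component_pi /= eqz_nat eq_sym.
- by rewrite path_component0; case: ifP.
- by rewrite path_componentD IHx IHy; case: ifP; rewrite ?addr0.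
- by rewrite path_componentZ IH; case: ifP; rewrite ?scaler0.
have [i0|] := ltP i 0.
  by rewrite (path_deg_lt0 xi i0) mul0r path_component0; case: ifP.
case: i xi IHx => // a xi IHx _; have [j0|] := ltP j 0.
  by rewrite (path_deg_lt0 yj j0) mulr0 path_component0; case: ifP.
case: j yj IHy => // b yj IHy _.
rewrite path_componentM -PoszD eqz_nat.
under eq_bigr do rewrite IHx IHy !eqz_nat.
have [an|na] := ltnP a n.+1; last first.
  rewrite big1 => [|[k /= kn] _].
    by case: eqP => // abn; move: na; rewrite -abn ltnNge leq_addr.
  by case: eqP => [ak|]; [move: kn; rewrite -ak ltnNge na|rewrite mul0r].
rewrite (bigD1 (Ordinal an)) //= eqxx big1 ?addr0; last first.
  move=> k /negPf kn; case: eqP => [ak|]; last by rewrite mul0r.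
  by move: kn; rewrite -val_eqE /= -ak eqxx.
have -> : (b == n - a)%N = (a + b == n)%N.
  by rewrite -(eqn_add2l a) subnKC.
by case: eqP; rewrite ?mulr0.
Qed.

Lemma path_deg_grading : is_grading path_deg.
Proof.
split.
- exact: pdeg_zero.
- exact: path_deg_sub.
- move=> x; apply: grading_span_of;
    [exact: pdeg_zero|exact: path_deg_sub|].
  elim/path_alg_ind: x => [v|e||x y|a x|x y].
  + exists [:: (0, pvertex v)]; last by rewrite big_seq1.
    by move=> p; rewrite inE => /eqP ->; apply: pdeg_vertex.
  + exists [:: (1, pedge e)]; last by rewrite big_seq1.
    by move=> p; rewrite inE => /eqP ->; apply: pdeg_edge.
  + by exists [::]; last by rewrite big_nil.
  + move=> [s Gs ->] [t Gt ->]; exists (s ++ t); last by rewrite big_cat.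
    by move=> p; rewrite mem_cat => /orP[/Gs|/Gt].
  + move=> [s Gs ->]; exists [seq (p.1, a *: p.2) | p <- s].
      by move=> _ /mapP[p ps ->]; apply: pdeg_scale (Gs p ps).
    by rewrite big_map scaler_sumr.
  + move=> [s Gs ->] [t Gt ->].
    exists [seq (p.1 + q.1, p.2 * q.2) | p <- s, q <- t].
      move=> _ /allpairsP[[p q] /= [ps qt ->]].
      exact: pdeg_mul (Gs p ps) (Gt q qt).
    rewrite big_allpairs_dep /= path_mul_suml; apply: eq_bigr => p _.
    by rewrite path_mul_sumr.
- move=> s c us Gc sum0 i si; have [/(path_deg_lt0 (Gc i)) //|] := ltP i 0.
  case: i si => // n si _.
  have := congr1 (path_component n) sum0.
  rewrite path_component0.
  rewrite (big_morph _ (path_componentD n) (path_component0 n)).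
  under eq_bigr do rewrite (path_component_deg (Gc _)).
  rewrite (bigD1_seq n%:Z) //= eqxx big1 ?addr0 //.
  by move=> j /negPf ->.
Qed.

Definition path_algebra : grRing :=
  GrRing path_deg_grading path_deg1 pdeg_mul.

End PathAlgebra.

(* Main.v *)
Require Import Defs.
From mathcomp Require Import all_boot all_order all_algebra.
From HB Require Import structures.
From mathcomp Require Import boolp monalg.

(** Write B for the path algebra, v B for the right ideal of a vertex v, and
    attach to a pair (v, k), called a label below, the graded module (v B)(k).
    It is projective, since a homomorphism out of v B is the choice of an
    element x with x v = x, and its generator has degree - k. The theorem
    follows once the monoid of isomorphism classes of graded finitely generated
    projective modules is known to be free on the labels: the shift by l sends
    (v, k) to (v, k + l), so the group completion is free over Z[t,t^-1] on the
    vertices ([free_completion_iso]).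

    Two facts about B are used: it lives in nonnegative degrees, and its degree
    0 part is the product of the fields K v. The coefficient of v in the degree
    0 part is a ring homomorphism B -> K ([vcoef]), the one that kills the edges
    and the other vertices.

    Every P is a sum of modules (v B)(k) ([fgp_iso_free]). Take a generating
    family of P, as small as possible, whose members x_i are homogeneous and
    satisfy x_i v_i = x_i. It gives a surjection pi from a sum F of modules
    (v B)(k), and projectivity gives a section h. By minimality, a homogeneous
    relation between the x_i has no coefficient with a component in degree 0:
    such a component is a nonzero multiple of v_i, which expresses x_i through
    the other generators. Hence 1 - h pi maps the generators of F into elements
    all of whose coordinates have positive degree. As 1 - h pi is the identity
    on the kernel of pi, iteration shows that the coordinates of an element of
    the kernel have no component in any degree. So pi is injective. This
    replaces Nakayama's lemma and the uniqueness of projective covers.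

    The labels are determined by the module ([fgp_free_iso_perm]). Write
    mutually inverse isomorphisms as matrices over B, keep the rows and columns
    with a given label (v, k) and apply the coefficient of v. Entries between
    (v, k) and another label have coefficient 0, for reasons of degree or
    because v w = 0, so the two matrices over K are still inverse to each other,
    and both sums contain the label equally often. *)

Set Implicit Arguments.
Unset Strict Implicit.
Unset Printing Implicit Defensive.

Import Order.TTheory GRing.Theory Num.Theory.
Local Open Scope ring_scope.

(** * Right actions and graded homomorphisms *)

Section RightAction.
Variables (B : pzRingType) (M : lmodType B^c).
Implicit Types (x y : M) (a b : B).

(** Scaling over the converse ring, written on the right so that associativity
    reads with the multiplication of B itself. *)
Definition ract x b : M := (b : B^c) *: x.
Local Notation "x ⋅ b" := (ract x b) (at level 40, left associativity).

Lemma ractA x a b : x ⋅ a ⋅ b = x ⋅ (a * b).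
Proof. exact: scalerA. Qed.

Lemma ract1 x : x ⋅ 1 = x.
Proof. exact: scale1r. Qed.

Lemma ract0 x : x ⋅ 0 = 0.
Proof. exact: scale0r. Qed.

Lemma ractDl x y b : (x + y) ⋅ b = x ⋅ b + y ⋅ b.
Proof. exact: scalerDr. Qed.

Lemma ractDr x a b : x ⋅ (a + b) = x ⋅ a + x ⋅ b.
Proof. exact: scalerDl. Qed.

Lemma ractN x b : (- x) ⋅ b = - (x ⋅ b).
Proof. exact: scalerN. Qed.

Lemma ract_suml (I : Type) (s : seq I) (P : pred I) (F : I -> M) b :
  (\sum_(i <- s | P i) F i) ⋅ b = \sum_(i <- s | P i) F i ⋅ b.
Proof. exact: scaler_sumr. Qed.

Lemma ract_sumr (I : Type) (s : seq I) (P : pred I) x (F : I -> B) :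
  x ⋅ (\sum_(i <- s | P i) F i) = \sum_(i <- s | P i) x ⋅ F i.
Proof. exact: (big_morph (ract x) (ractDr x) (ract0 x)). Qed.

End RightAction.

Notation "x ⋅ b" := (ract x b) (at level 40, left associativity).

Section HomogeneousComponent.
Variables (V : zmodType) (G : int -> V -> Prop).
Hypothesis gradG : is_grading G.

(** Decompositions into homogeneous components are given as families over a
    duplicate-free sequence of degrees, which may omit k. *)
Lemma grading_component_unique k y (s : seq int) (d : int -> V) :
  G k y -> uniq s -> (forall i, G i (d i)) -> y = \sum_(i <- s) d i ->
  y = if k \in s then d k else 0.
Proof.
have [G0 GB _ Gf] := gradG.
move=> Gy us Gd Ey; pose d' i := (if i \in s then d i else 0) -
  (if i == k then y else 0).
have Gd' i : G i (d' i).
  by apply: GB; [case: ifP|case: eqP => [->|]].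
(* The family [d'] sums to 0 over a range that contains k. *)
have ek : k \in undup (k :: s) by rewrite mem_undup mem_head.
have /(_ _ k ek) := Gf (undup (k :: s)) d' (undup_uniq _) Gd'.
rewrite /d' eqxx => E; apply/esym/eqP; rewrite -subr_eq0; apply/eqP/E.
rewrite sumrB [X in _ - X](bigD1_seq k) ?undup_uniq // eqxx.
rewrite [X in _ - (_ + X)]big1 ?addr0 => [|i /negPf -> //].
rewrite [X in X - _](_ : _ = y) ?subrr // [RHS]Ey.
rewrite -big_mkcond -big_filter; apply: perm_big.
apply: uniq_perm; [exact: (filter_uniq _ (undup_uniq (k :: s)))|by []|move=> i].
by rewrite mem_filter mem_undup inE; case: (i \in s) => //=; rewrite orbT.
Qed.

End HomogeneousComponent.

Section GrHom.
Variables (B : grRing) (M N : grModule B) (f : M -> N).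
Hypothesis fh : gr_hom f.

Lemma gr_hom_ract x b : f (x ⋅ b) = f x ⋅ b.
Proof. by case: fh => /linear_mapZ fZ _; apply: fZ. Qed.

Lemma gr_homD x y : f (x + y) = f x + f y.
Proof. by case: fh => /linear_mapD fD _; apply: fD. Qed.

Lemma gr_hom0 : f 0 = 0.
Proof. by case: fh => /linear_map0. Qed.

Lemma gr_homN x : f (- x) = - f x.
Proof. by apply/eqP; rewrite -addr_eq0 -gr_homD addNr gr_hom0. Qed.

Lemma gr_hom_sum (I : Type) (s : seq I) (P : pred I) (F : I -> M) :
  f (\sum_(i <- s | P i) F i) = \sum_(i <- s | P i) f (F i).
Proof. exact: (big_morph f gr_homD gr_hom0). Qed.

(** The component of degree k of any preimage of y is again a preimage, because
    f respects the decomposition into components. *)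
Lemma gr_surj_homogeneous k y :
  gr_surj f -> gm_deg k y -> exists2 x, gm_deg k x & f x = y.
Proof.
move=> fs yk; have [x fx] := fs y; have [M0 _ Ms _] := gm_grading M.
have [s [c [us Gc Ex]]] := Ms x.
have Ey : y = \sum_(i <- s) f (c i) by rewrite -fx Ex gr_hom_sum.
have fG i : gm_deg i (f (c i)) by case: fh => _; apply.
have E := grading_component_unique (gm_grading N) yk us fG Ey.
exists (if k \in s then c k else 0); first by case: ifP.
by rewrite E; case: ifP; rewrite ?gr_hom0.
Qed.

End GrHom.

Section GradedModuleLemmas.
Variables (B : grRing) (M : grModule B).

Lemma gm_deg0 k : gm_deg k (0 : M).
Proof. by case: (gm_grading M). Qed.

Lemma gm_degD k (x y : M) : gm_deg k x -> gm_deg k y -> gm_deg k (x + y).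
Proof. by case: (gm_grading M) => ? ? _ _; apply: gradingD_of. Qed.

Lemma gm_degB k (x y : M) : gm_deg k x -> gm_deg k y -> gm_deg k (x - y).
Proof. by case: (gm_grading M) => _ GB _ _; apply: GB. Qed.

Lemma gm_deg_sum k (I : Type) (s : seq I) (F : I -> M) :
  (forall i, gm_deg k (F i)) -> gm_deg k (\sum_(i <- s) F i).
Proof.
by move=> FG; elim/big_rec: _ => [|i x _]; [apply: gm_deg0|apply: gm_degD].
Qed.

Lemma gm_deg_ract i j k (x : M) (b : B) :
  gm_deg i x -> gr_deg j b -> k = i + j -> gm_deg k (x ⋅ b).
Proof. by move=> xi bj ->; apply: gm_degZ. Qed.

End GradedModuleLemmas.

(** * Vertex coefficients in the path algebra *)

Section PathCoefficient.
Variables (K : fieldType) (E : digraph).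
Local Notation B := (path_alg K E).
Implicit Types (v w : vertex E) (x y : B).

Fixpoint term_vcoef v (t : path_term K E) : K :=
  match t with
  | PVertex w => (w == v)%:R
  | PEdge _ => 0
  | PZero => 0
  | PAdd s t => term_vcoef v s + term_vcoef v t
  | PScale a t => a * term_vcoef v t
  | PMul s t => term_vcoef v s * term_vcoef v t
  end.

(** The assignment v |-> 1 and 0 on the edges and the other vertices satisfies
    the relations of the path algebra, so it extends to a K-algebra
    homomorphism. *)
Lemma term_vcoef_eq v s t : path_eq s t -> term_vcoef v s = term_vcoef v t.
Proof.
elim=> //=; try by move=> *; congruence.
- by move=> *; rewrite addrA.
- by move=> *; rewrite addrC.
- by move=> *; rewrite add0r.
- by move=> *; rewrite mulN1r addNr.
- by move=> *; rewrite mulrA.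
- by move=> *; rewrite mul1r.
- by move=> *; rewrite mulrDr.
- by move=> *; rewrite mulrDl.
- by move=> *; rewrite mulrA.
- by move=> *; rewrite mulrDl.
- by move=> *; rewrite mulrDr.
- by move=> *; rewrite mulrA.
- by move=> *; rewrite mulrCA.
- move=> u w; have [<-|uw] := eqVneq u w => /=.
    by rewrite -natrM mulnb andbb.
  rewrite -natrM mulnb; case: eqP => //= uv; case: eqP => //= wv.
  by rewrite uv wv eqxx in uw.
- by move=> *; rewrite mulr0.
- by move=> *; rewrite mul0r.
Qed.

Definition vcoef v x : K := term_vcoef v (repr x).

Lemma vcoef_pi v t : vcoef v (path_pi t) = term_vcoef v t.
Proof. by apply: term_vcoef_eq; apply: path_repr_pi. Qed.

Lemma vcoefD v x y : vcoef v (x + y) = vcoef v x + vcoef v y.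
Proof.
have [s ->] := path_piS x; have [t ->] := path_piS y.
by rewrite -path_piD !vcoef_pi.
Qed.

Lemma vcoefZ v (a : K) x : vcoef v (a *: x) = a * vcoef v x.
Proof. by have [s ->] := path_piS x; rewrite -path_piZ !vcoef_pi. Qed.

Lemma vcoefM v x y : vcoef v (x * y) = vcoef v x * vcoef v y.
Proof.
have [s ->] := path_piS x; have [t ->] := path_piS y.
by rewrite [_ * _]path_mulE !vcoef_pi.
Qed.

Lemma vcoef_vertex v w : vcoef v (pvertex K w) = (w == v)%:R.
Proof. exact: vcoef_pi. Qed.

Lemma vcoef0 v : vcoef v 0 = 0.
Proof. exact: vcoef_pi. Qed.

Lemma vcoef_sum v (I : Type) (s : seq I) (P : pred I) (F : I -> B) :
  vcoef v (\sum_(i <- s | P i) F i) = \sum_(i <- s | P i) vcoef v (F i).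
Proof. exact: (big_morph (vcoef v) (vcoefD v) (vcoef0 v)). Qed.

Lemma vcoef_deg i v x : path_deg i x -> i != 0 -> vcoef v x = 0.
Proof.
elim=> {i x} [w|e|i|i x y _ IHx _ IHy|i a x _ IH|i j x y _ IHx _ IHy] i0.
- by rewrite eqxx in i0.
- exact: vcoef_pi.
- exact: vcoef0.
- by rewrite vcoefD IHx // IHy // addr0.
- by rewrite vcoefZ IH // mulr0.
- rewrite vcoefM; have [i1|/IHx ->] := eqVneq i 0; last by rewrite mul0r.
  by rewrite IHy ?mulr0 //; apply: contraNneq i0 => ->; rewrite i1 addr0.
Qed.

Lemma path_vertexM v w :
  pvertex K v * pvertex K w = if v == w then pvertex K v else 0 :> B.
Proof. exact: path_mul_vertex. Qed.

Lemma path_vertex_sum : \sum_v pvertex K v = 1 :> B.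
Proof. by []. Qed.

(** The degree 0 part is spanned by the orthogonal idempotents v: both sides are
    multiplicative in x. *)
Lemma path_component0E x :
  path_component 0 x = \sum_v vcoef v x *: pvertex K v.
Proof.
elim/path_alg_ind: x => [w|e||x y Ex Ey|a x Ex|x y Ex Ey].
- rewrite path_component_pi /= (bigD1 w) //= vcoef_vertex eqxx scale1r.
  rewrite big1 ?addr0 // => v; rewrite vcoef_vertex eq_sym => /negPf ->.
  exact: scale0r.
- rewrite path_component_pi big1 // => v _.
  by rewrite [vcoef _ _]vcoef_pi scale0r.
- by rewrite path_component0 big1 // => v _; rewrite vcoef0 scale0r.
- rewrite path_componentD Ex Ey -big_split; apply: eq_bigr => v _.
  by rewrite vcoefD scalerDl.
- rewrite path_componentZ Ex scaler_sumr; apply: eq_bigr => v _.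
  by rewrite vcoefZ scalerA.
- rewrite -[path_mul x y]/(x * y) path_componentM big_ord1 subnn Ex Ey.
  rewrite mulr_suml; apply: eq_bigr => v _.
  rewrite mulr_sumr (bigD1 v) //= big1 ?addr0 => [|w wv].
    rewrite -[LHS]path_scaleAl -[path_mul _ _]path_scaleAr scalerA.
    by rewrite [path_mul _ _]path_vertexM eqxx vcoefM.
  rewrite -[LHS]path_scaleAl -[path_mul _ _]path_scaleAr.
  by rewrite [path_mul _ _]path_vertexM eq_sym (negPf wv) !scaler0.
Qed.

Lemma path_component_inj x : (forall n, path_component n x = 0) -> x = 0.
Proof.
move=> x0; have [_ _ Gs _] := path_deg_grading K E.
have [s [c [us Gc Ex]]] := Gs x.
rewrite Ex big_seq big1 // => i si; have [i0|] := ltP i 0.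
  exact: path_deg_lt0 (Gc i) i0.
case: i si => // n si _; have := x0 n; rewrite Ex.
rewrite (big_morph _ (path_componentD n) (path_component0 K E n)).
under eq_bigr do rewrite (path_component_deg (Gc _)).
rewrite (bigD1_seq n%:Z) //= eqxx big1 ?addr0 //.
by move=> j /negPf ->.
Qed.

End PathCoefficient.

(** * The projective modules given by the vertices *)

Section VertexModule.
Variables (K : fieldType) (E : digraph) (v : vertex E).
Local Notation B := (path_alg K E).

(** The right ideal v B, as the elements fixed by left multiplication by v.
    Scaling over the converse ring is multiplication on the right, so it is a
    submodule of the regular module over B^c. *)
Definition vertex_ideal : {pred (B^c)^o} :=
  fun x => pvertex K v * (x : B) == x.

Lemma vertex_ideal_submod : GRing.submod_closed vertex_ideal.
Proof.
split=> [|b x y /eqP Ex /eqP Ey]; first by rewrite unfold_in mulr0.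
by rewrite unfold_in; apply/eqP; rewrite mulrDr [in RHS]/(_ *: _) /= -{2}Ex
  -{2}Ey /GRing.scale /= mulrA.
Qed.

HB.instance Definition _ :=
  GRing.isSubmodClosed.Build B^c (B^c)^o vertex_ideal vertex_ideal_submod.

Record vertex_mod := VertexMod
  { vmod_val :> (B^c)^o; _ : vmod_val \in vertex_ideal }.

HB.instance Definition _ := [isSub for vmod_val].
HB.instance Definition _ := [Choice of vertex_mod by <:].
HB.instance Definition _ := [SubChoice_isSubLmodule of vertex_mod by <:].

(** The projection to B rather than to its converse, so that products are those
    of B. *)
Definition vval (x : vertex_mod) : B := vmod_val x.

Lemma vval_inj : injective vval.
Proof. exact: val_inj. Qed.

Lemma vvalP x : pvertex K v * vval x = vval x.
Proof. by case: x => x xP; apply/eqP. Qed.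

Lemma vvalD : {morph vval : x y / x + y}.
Proof. by []. Qed.

Lemma vval_ract (x : vertex_mod) (b : B) : vval (x ⋅ b) = vval x * b.
Proof. by []. Qed.

Lemma vval_sum (I : Type) (s : seq I) (P : pred I) (F : I -> vertex_mod) :
  vval (\sum_(i <- s | P i) F i) = \sum_(i <- s | P i) vval (F i).
Proof. exact: (big_morph vval vvalD). Qed.

Lemma vmod_of_subproof (b : B) : pvertex K v * b \in vertex_ideal.
Proof. by rewrite unfold_in mulrA path_vertexM eqxx. Qed.

Definition vmod_of (b : B) : vertex_mod := VertexMod (vmod_of_subproof b).

Definition vmod_deg (i : int) (x : vertex_mod) : Prop := path_deg i (vval x).

Lemma vmod_grading : is_grading vmod_deg.
Proof.
have [G0 GB Gs Gf] := path_deg_grading K E.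
split=> [i|i x y xi yi|x|s c us Gc E0 i si].
- exact: G0.
- exact: GB.
- have [s [c [us Gc Ex]]] := Gs (vval x).
  exists s, (vmod_of \o c); split=> // [i|].
    by have := pdeg_mul (pdeg_vertex K v) (Gc i); rewrite add0r.
  by apply: vval_inj; rewrite vval_sum -vvalP Ex mulr_sumr.
- apply: vval_inj; apply: (Gf s (vval \o c)) => //.
  by rewrite -vval_sum E0.
Qed.

Lemma vmod_degZ i j (x : vertex_mod) (b : path_algebra K E) :
  vmod_deg i x -> gr_deg j b ->
  vmod_deg (i + j) ((b : (path_algebra K E)^c) *: x).
Proof. exact: pdeg_mul. Qed.

Definition gm_vertex : grModule (path_algebra K E) :=
  @GrModule (path_algebra K E) vertex_mod vmod_deg vmod_grading vmod_degZ.

Definition vmod_gen : gm_vertex := vmod_of 1.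

Lemma vval_gen : vval vmod_gen = pvertex K v.
Proof. exact: mulr1. Qed.

Lemma vmod_genP (x : gm_vertex) : x = vmod_gen ⋅ vval x.
Proof. by apply: vval_inj; rewrite vval_ract vval_gen vvalP. Qed.

Lemma gm_vertex_fg : gr_fg gm_vertex.
Proof.
exists 1%N, (fun=> vmod_gen) => x; exists (fun=> vval x).
by rewrite big_ord1; apply: vmod_genP.
Qed.

(** A lift of f is x |-> m x, for m a degree 0 preimage under g of the value of
    f at the generator v. *)
Lemma gm_vertex_projective : gr_projective gm_vertex.
Proof.
move=> M N g f gh gs fh.
have [|m m0 gm] := gr_surj_homogeneous gh gs (k := 0) (y := f vmod_gen).
  case: fh => _; apply; rewrite /= /vmod_deg vval_gen; exact: pdeg_vertex.
exists (fun x => m ⋅ vval x).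
  split=> [a x y|i x xi].
    by rewrite vvalD ractDr -[a *: x]/(x ⋅ (a : B)) vval_ract -ractA.
  by apply: gm_deg_ract m0 xi _; rewrite add0r.
by move=> x; rewrite (gr_hom_ract gh) gm -(gr_hom_ract fh) -vmod_genP.
Qed.

Definition fgp_vertex : fgp (path_algebra K E) :=
  Fgp gm_vertex_fg gm_vertex_projective.

End VertexModule.

(** * Sums of shifted vertex modules *)

Section FreeModules.
Variables (K : fieldType) (E : digraph).
Local Notation B := (path_alg K E).
Local Notation A := (path_algebra K E).
Local Notation label := (vertex E * int)%type.
Implicit Types (c : label) (s t : seq label).

(** The shift by k moves the generator v to degree - k. *)
Definition fgp_label c : fgp A := fgp_shift c.2 (fgp_vertex K c.1).

Definition fgp_free s : fgp A :=
  foldr (fun c => fgp_sum (fgp_label c)) (fgp_zero A) s.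

Fixpoint free_coord s : nat -> fgp_free s -> B :=
  match s with
  | [::] => fun _ _ => 0
  | c :: s' => fun i x => if i is i'.+1 then free_coord i' x.2 else vval x.1
  end.

Fixpoint free_gen s : nat -> fgp_free s :=
  match s with
  | [::] => fun=> 0
  | c :: s' => fun i =>
      if i is i'.+1 then (0, free_gen s' i') else (vmod_gen K c.1, 0)
  end.

(* Only positions below the size of s are looked up, so [c0] is never read. *)
Variable c0 : label.
Local Notation lbl s i := (nth c0 s i).

Lemma free_coordD s i (x y : fgp_free s) :
  free_coord i (x + y) = free_coord i x + free_coord i y.
Proof.
by elim: s i x y => [|c s IH] [|i] x y /=; rewrite ?addr0.
Qed.

Lemma free_coord_ract s i (x : fgp_free s) (b : B) :
  free_coord i (x ⋅ b) = free_coord i x * b.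
Proof. elim: s i x => [|c s IH] [|i] x /=; rewrite ?mul0r //.
exact: IH. Qed.

Lemma free_coord0 s i : free_coord i (0 : fgp_free s) = 0.
Proof. by elim: s i => [|c s IH] [|i] //=; apply: IH. Qed.

Lemma free_coord_sum s i (I : Type) (r : seq I) (P : pred I)
    (F : I -> fgp_free s) :
  free_coord i (\sum_(j <- r | P j) F j)
  = \sum_(j <- r | P j) free_coord i (F j).
Proof.
exact: (big_morph (@free_coord s i) (@free_coordD s i) (@free_coord0 s i)).
Qed.

Lemma free_coord_vertex s i (x : fgp_free s) : (i < size s)%N ->
  pvertex K (lbl s i).1 * free_coord i x = free_coord i x.
Proof.
by elim: s i x => [|c s IH] [|i] x //= si; [apply: vvalP|apply: IH].
Qed.

Lemma free_coord_deg s i d (x : fgp_free s) :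
  (i < size s)%N -> gm_deg d x -> path_deg ((lbl s i).2 + d) (free_coord i x).
Proof. by elim: s i x => [|c s IH] [|i] x //= si [x1 x2] //; apply: IH. Qed.

Lemma free_coord_gen s i j : (i < size s)%N ->
  free_coord j (free_gen s i) = if i == j then pvertex K (lbl s i).1 else 0.
Proof.
elim: s i j => [|c s IH] [|i] [|j] //= si; last by rewrite IH.
- exact: vval_gen.
- exact: free_coord0.
Qed.

Lemma free_gen_deg s i : (i < size s)%N ->
  gm_deg (- (lbl s i).2) (free_gen s i).
Proof.
elim: s i => [|c s IH] [|i] //= si; split=> /=; try exact: gm_deg0.
  by rewrite /gm_shift_deg /= subrr /vmod_deg vval_gen; apply: pdeg_vertex.
  exact: (@gm_deg0 _ (gm_vertex K c.1)).
exact: IH.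
Qed.

(** The coordinates are those with respect to the generators: an element q of
    v B equals v q. *)
Lemma free_expand s (x : fgp_free s) :
  x = \sum_(i < size s) free_gen s i ⋅ free_coord i x.
Proof.
elim: s x => [|c s IH] x; first exact: gm_zero_eq.
case: x => x y; rewrite big_ord_recl.
transitivity ((x, 0) + (0, y) : fgp_free (c :: s)).
  by congr (_, _); rewrite ?addr0 ?add0r.
congr (_ + _).
  by congr (_, _); [apply: vmod_genP|rewrite [RHS]scaler0].
transitivity
  (\sum_(i < size s)
     ((0, free_gen s i ⋅ free_coord i y) : fgp_free (c :: s))).
  by rewrite [RHS]sum_pair big1_eq {1}[y]IH.
by apply: eq_bigr => i _; congr (_, _); rewrite [RHS]scaler0.
Qed.

Lemma free_coord_ext s (x y : fgp_free s) :
  (forall i, (i < size s)%N -> free_coord i x = free_coord i y) -> x = y.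
Proof.
move=> xy; rewrite [x]free_expand [RHS]free_expand; apply: eq_bigr => i _.
by rewrite xy.
Qed.

End FreeModules.

(** * Minimal generating families *)

Section Generators.
Variables (K : fieldType) (E : digraph).
Local Notation B := (path_alg K E).
Local Notation A := (path_algebra K E).
Local Notation label := (vertex E * int)%type.
Variable P : grModule A.
Implicit Types (L : seq (label * P)) (p : label * P) (x y : P).

Lemma some_label L i : (i < size L)%N -> label.
Proof. by case: L => [|[c ?] ?]. Qed.

(** Exactly the condition under which the generator of the module with label
    p.1 can be sent to p.2. *)
Definition label_fits p : Prop :=
  gm_deg (- p.1.2) p.2 /\ p.2 ⋅ pvertex K p.1.1 = p.2.

Definition in_span L y : Prop :=
  exists b : nat -> B, y = \sum_(i < size L) nth 0 (unzip2 L) i ⋅ b i.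

Definition labelled_generators L : Prop :=
  (forall p, p \in L -> label_fits p) /\ forall y, in_span L y.

Lemma in_span0 L : in_span L 0.
Proof. by exists (fun=> 0); rewrite big1 // => i _; apply: ract0. Qed.

Lemma in_spanD L x y : in_span L x -> in_span L y -> in_span L (x + y).
Proof.
move=> [b ->] [c ->]; exists (fun i => b i + c i).
by rewrite -big_split; apply: eq_bigr => i _; rewrite ractDr.
Qed.

Lemma in_span_ract L x (b : B) : in_span L x -> in_span L (x ⋅ b).
Proof.
move=> [c ->]; exists (fun i => c i * b).
by rewrite ract_suml; apply: eq_bigr => i _; rewrite ractA.
Qed.

Lemma in_span_sum L (I : Type) (s : seq I) (Q : pred I) (F : I -> P) :
  (forall i, Q i -> in_span L (F i)) -> in_span L (\sum_(i <- s | Q i) F i).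
Proof.
move=> FL; elim/big_rec: _ => [|i x Qi]; first exact: in_span0.
exact/in_spanD/FL.
Qed.

Lemma in_span_mem L p : p \in L -> in_span L p.2.
Proof.
move=> pL; have iL : (index p L < size L)%N by rewrite index_mem.
exists (fun i => if i == index p L then 1 else 0).
rewrite (bigD1 (Ordinal iL)) //= eqxx ract1 (nth_map p) // nth_index //.
rewrite big1 ?addr0 // => i; rewrite -val_eqE /= => /negPf ->.
exact: ract0.
Qed.

(** Split into homogeneous components, and each of these by 1 = sum of the
    vertices. *)
Lemma homogeneous_decomposition y : exists L,
  (forall p, p \in L -> label_fits p) /\ y = \sum_(p <- L) p.2.
Proof.
have [_ _ Gs _] := gm_grading P; have [s [c [_ Gc ->]]] := Gs y.
exists [seq ((v, - i), c i ⋅ pvertex K v) | i <- s, v <- enum (vertex E)].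
split.
  move=> _ /allpairsP[[i v] [_ _ ->]]; split=> /=.
    by apply: gm_deg_ract (Gc i) (pdeg_vertex _ v) _; rewrite opprK addr0.
  by rewrite ractA path_vertexM eqxx.
rewrite big_allpairs_dep; apply: eq_bigr => i _ /=.
by rewrite big_enum -ract_sumr path_vertex_sum ract1.
Qed.

Lemma labelled_generators_exist : gr_fg P -> exists L, labelled_generators L.
Proof.
move=> [n [g gP]].
have /choice[L LP] := fun i : 'I_n => homogeneous_decomposition (g i).
exists (flatten [seq L i | i <- enum 'I_n]); split.
  by move=> p /flattenP[_ /mapP[i _ ->]]; case: (LP i) => + _; apply.
move=> y; have [b ->] := gP y; apply: in_span_sum => i _.
apply: in_span_ract; case: (LP i) => _ ->; rewrite big_seq.
apply: in_span_sum => p pL; apply: in_span_mem; apply/flattenP.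
by exists (L i) => //; apply: map_f; rewrite mem_enum.
Qed.

Definition minimal_generators L : Prop := labelled_generators L /\
  forall L', labelled_generators L' -> (size L <= size L')%N.

Lemma minimal_generators_exist : gr_fg P -> exists L, minimal_generators L.
Proof.
move=> /labelled_generators_exist[L0 L0P].
have ex : exists n, `[< exists2 L, labelled_generators L & size L = n >].
  by exists (size L0); apply/asboolP; exists L0.
case: (ex_minnP ex) => n /asboolP[L LP sL] nmin; exists L; split=> // L' L'P.
by rewrite sL; apply: nmin; apply/asboolP; exists L'.
Qed.

Section Cover.
Variable L : seq (label * P).
Hypothesis Lgen : labelled_generators L.

Lemma nth_label_fits c0 i : (i < size L)%N ->
  label_fits (nth c0 (unzip1 L) i, nth 0 (unzip2 L) i).
Proof.
move=> iL; case: Lgen => /(_ (nth (c0, 0) L i) (mem_nth _ iL)) + _.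
by rewrite (nth_map (c0, 0)) // (nth_map (c0, 0)) //; case: nth.
Qed.

(** The homomorphism that sends the i-th generator to the i-th member of L. *)
Definition free_cover (y : fgp_free K (unzip1 L)) : P :=
  \sum_(i < size L) nth 0 (unzip2 L) i ⋅ free_coord i y.

Lemma free_cover_hom : gr_hom free_cover.
Proof.
split=> [a x y|d y yd].
  rewrite /free_cover -[a *: x]/(x ⋅ (a : B)).
  rewrite -[a *: \sum_(_ | _) _]/(_ ⋅ (a : B)).
  rewrite ract_suml -big_split; apply: eq_bigr => i _ /=.
  by rewrite free_coordD free_coord_ract ractDr ractA.
apply: gm_deg_sum => i; have iL := ltn_ord i.
have c0 := some_label iL.
have [xi _] := nth_label_fits c0 iL.
apply: gm_deg_ract xi (free_coord_deg c0 _ yd) _; first by rewrite size_map.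
by rewrite addKr.
Qed.

Lemma free_cover_surj : gr_surj free_cover.
Proof.
move=> y; case: Lgen => _ /(_ y)[b ->].
exists (\sum_(i < size L) free_gen K (unzip1 L) i ⋅ b i).
apply: eq_bigr => i _; have iL := ltn_ord i.
have c0 := some_label iL.
have [_ /= xi] := nth_label_fits c0 iL.
rewrite free_coord_sum (bigD1 i) //= big1 => [|j /negPf ji].
  rewrite free_coord_ract (free_coord_gen _ c0) ?size_map // eqxx addr0.
  by rewrite -ractA xi.
by rewrite free_coord_ract (free_coord_gen _ c0) ?size_map // val_eqE ji mul0r.
Qed.

End Cover.

(** Otherwise the relation [free_cover y = 0] can be solved for the j-th
    generator, and the family without it still generates. *)
Lemma minimal_generators_relation_deg0 L d (y : fgp_free K (unzip1 L)) j :
  minimal_generators L -> gm_deg d y -> free_cover y = 0 -> (j < size L)%N ->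
  path_component 0 (free_coord j y) = 0.
Proof.
move=> [Lgen Lmin] yd y0 jL.
have c0 := some_label jL.
set b := free_coord j y; set w := (nth c0 (unzip1 L) j).1.
have jL' : (j < size (unzip1 L))%N by rewrite size_map.
have bd : path_deg _ b := free_coord_deg c0 jL' yd.
have wb : pvertex K w * b = b := free_coord_vertex c0 y jL'.
(* As w b = b, no other vertex than w occurs in degree 0. *)
have bE : path_component 0 b = vcoef w b *: pvertex K w.
  rewrite path_component0E (bigD1 w) //= big1 ?addr0 // => v vw.
  by rewrite -wb vcoefM vcoef_vertex eq_sym (negPf vw) mul0r scale0r.
rewrite bE; have [->|bw] := eqVneq (vcoef w b) 0; first exact: scale0r.
(* A homogeneous element with a nonzero coefficient has degree 0. *)
have b0 : b = vcoef w b *: pvertex K w.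
  rewrite -bE (path_component_deg bd); case: eqP => // /eqP b0.
  by rewrite (vcoef_deg _ bd b0) eqxx in bw.
pose L' := take j L ++ drop j.+1 L.
have inL' i : (i < size L)%N -> i != j -> nth (c0, 0) L i \in L'.
  move=> iL ij; rewrite mem_cat; have [lt|gt|eq] := ltngtP i j.
  - by rewrite -(nth_take _ lt) mem_nth // size_take jL.
  - apply/orP; right; have -> : i = (j.+1 + (i - j.+1))%N by rewrite subnKC.
    by rewrite -nth_drop mem_nth // size_drop ltn_sub2r // (leq_ltn_trans gt).
  - by rewrite eq eqxx in ij.
have spanL i : (i < size L)%N -> in_span L' (nth 0 (unzip2 L) i).
  move=> iL; have [ij|ij] := eqVneq i j; last first.
    by rewrite (nth_map (c0, 0)) //; apply: in_span_mem; apply: inL'.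
  have [_ /= xw] := nth_label_fits Lgen c0 jL.
  (* Multiplying the relation by [e] turns the coefficient [b] into - w. *)
  pose e : B := - ((vcoef w b)^-1 *: pvertex K w).
  have be : b * e = - pvertex K w.
    rewrite mulrN; congr (- _).
    rewrite {1}b0 -[LHS]path_scaleAl -[path_mul _ _]path_scaleAr scalerA.
    by rewrite divff // scale1r [LHS]path_vertexM eqxx.
  have := congr1 (fun z => ract z e) y0; rewrite /free_cover ract_suml.
  rewrite (bigD1 (Ordinal jL)) //= ractA be.
  rewrite [_ ⋅ (- _)]scaleNr -/(_ ⋅ _) xw [0 ⋅ e]scaler0 => /eqP.
  rewrite addrC subr_eq0 ij => /eqP <-; apply: in_span_sum => k kj.
  do 2!apply: in_span_ract; rewrite (nth_map (c0, 0)) //.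
  by apply: in_span_mem; apply: inL'.
have : (size L <= size L')%N.
  apply: Lmin; case: Lgen => Lfit Lspan; split=> [p pL'|z].
    apply: Lfit; move: pL'; rewrite mem_cat => /orP[/mem_take|/mem_drop] //.
  have [u ->] := Lspan z; apply: in_span_sum => i _.
  by apply: in_span_ract; apply: spanL.
rewrite size_cat size_take jL size_drop leqNgt.
by rewrite -addnS subnSK // subnKC ?leqnn // ltnW.
Qed.

End Generators.

(** * Classification of the graded projective modules *)

Section Structure.
Variables (K : fieldType) (E : digraph).
Local Notation B := (path_alg K E).
Local Notation A := (path_algebra K E).
Local Notation label := (vertex E * int)%type.

(** The endomorphism 1 - h pi raises the order of vanishing of every coordinate
    and fixes the kernel of pi, so the coordinates of an element of the kernel
    vanish to every order. *)
Lemma minimal_free_cover_kernel0 (P : fgp A) (L : seq (label * P)) :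
  minimal_generators L ->
  forall y : fgp_free K (unzip1 L), free_cover y = 0 -> y = 0.
Proof.
move=> Lmin; have [Lgen _] := Lmin; pose s := unzip1 L.
have ph := free_cover_hom Lgen.
have [h hh hE] :=
  @fgp_projective _ P _ _ _ _ ph (free_cover_surj Lgen) (gr_hom_id P).
(* The image of the i-th generator under 1 - h pi, an element of the kernel. *)
pose u i : fgp_free K s := free_gen K s i - h (free_cover (free_gen K s i)).
have szs : size s = size L by rewrite size_map.
have u0 i j : (i < size L)%N -> (j < size L)%N ->
    path_component 0 (free_coord j (u i)) = 0.
  move=> iL jL; have c0 := some_label iL.
  have gi : gm_deg (- (nth c0 s i).2) (free_gen K s i).
    by apply: free_gen_deg; rewrite szs.
  apply: (minimal_generators_relation_deg0 (d := - (nth c0 s i).2) Lmin) => //.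
    apply: gm_degB => //; case: hh => _; apply; case: ph => _; exact.
  by rewrite (gr_homD ph) (gr_homN ph) hE subrr.
have yE (y : fgp_free K (unzip1 L)) : free_cover y = 0 ->
    y = \sum_(i < size s) u i ⋅ free_coord i y.
  move=> y0; rewrite {1}[y]free_expand; under [RHS]eq_bigr do
    rewrite ractDl ractN -(gr_hom_ract hh) -(gr_hom_ract ph).
  rewrite sumrB -(gr_hom_sum hh) -(gr_hom_sum ph) -free_expand y0.
  by rewrite (gr_hom0 hh) subr0.
have low k (y : fgp_free K (unzip1 L)) : free_cover y = 0 ->
    forall j, (j < size L)%N -> forall m, (m < k)%N ->
    path_component m (free_coord j y) = 0.
  elim: k y => // k IH y y0 j jL m; rewrite ltnS => mk.
  rewrite (yE y y0) free_coord_sum.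
  rewrite (big_morph _ (path_componentD m) (path_component0 K E m)).
  rewrite big1 // => i _; have iL : (i < size L)%N by rewrite -szs.
  (* The factor of degree 0 vanishes, so the other factor has degree below m. *)
  rewrite free_coord_ract path_componentM big_ord_recl /= u0 // mul0r add0r.
  rewrite big1 // => a _; rewrite (IH y) ?mulr0 //.
  apply: leq_trans mk; rewrite /bump /= add1n ltn_subrL /=.
  by apply: leq_ltn_trans (ltn_ord a).
move=> y y0; apply: free_coord_ext => i; rewrite szs => iL.
rewrite free_coord0; apply: path_component_inj => n.
exact: (low n.+1).
Qed.

Lemma fgp_iso_free (P : fgp A) : exists s, fgp_iso P (fgp_free K s).
Proof.
have [L Lmin] := minimal_generators_exist (fgp_fg P).
have [Lgen _] := Lmin; have ph := free_cover_hom Lgen.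
have [h hh hE] :=
  @fgp_projective _ P _ _ _ _ ph (free_cover_surj Lgen) (gr_hom_id P).
exists (unzip1 L), h, (@free_cover _ _ _ L); split=> // y; apply/eqP.
rewrite -subr_eq0; apply/eqP; apply: minimal_free_cover_kernel0 => //.
by rewrite (gr_homD ph) (gr_homN ph) hE subrr.
Qed.

Section Rank.
Variables (s t : seq label) (f : fgp_free K s -> fgp_free K t)
  (g : fgp_free K t -> fgp_free K s).
Hypotheses (fh : gr_hom f) (gh : gr_hom g) (fK : cancel f g).

(** The coefficients at c.1 of the entries of f and g between generators with
    label c form matrices F and G over K with F G = 1. The generators of the
    middle module with a label different from c do not contribute to g f. *)
Lemma free_label_count c : (count_mem c s <= count_mem c t)%N.
Proof.
pose I := [set i : 'I_(size s) | nth c s i == c].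
pose J := [set j : 'I_(size t) | nth c t j == c].
have cardI (r : seq label) :
    #|[set i : 'I_(size r) | nth c r i == c]| = count_mem c r.
  rewrite -sum1_card -sum1_count (big_nth c) big_mkord.
  by apply: eq_bigl => i; rewrite inE.
rewrite -[count_mem c s]cardI -[count_mem c t]cardI -/I -/J.
pose F := \matrix_(a < #|I|, b < #|J|)
  vcoef c.1 (free_coord (enum_val b) (f (free_gen K s (enum_val a)))).
pose G := \matrix_(b < #|J|, a < #|I|)
  vcoef c.1 (free_coord (enum_val a) (g (free_gen K t (enum_val b)))).
suff : F *m G = 1%:M by apply: mulmx1_min.
have lI (a : 'I_#|I|) : nth c s (enum_val a) = c.
  by have := enum_valP a; rewrite inE => /eqP.
apply/matrixP => a a'; rewrite !mxE.
set i := enum_val a; set i' := enum_val a'.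
have E1 : vcoef c.1 (free_coord i' (free_gen K s i)) = (a == a')%:R.
  rewrite (free_coord_gen _ c) // lI -(inj_eq enum_val_inj) -val_eqE.
  by case: eqP => _; rewrite ?vcoef0 // vcoef_vertex eqxx.
rewrite -E1 -{1}[free_gen K s i]fK [f _ in RHS]free_expand (gr_hom_sum gh).
rewrite free_coord_sum vcoef_sum (bigID (mem J)) /= [X in _ = _ + X]big1.
  rewrite addr0 [RHS]big_enum_val; apply: eq_bigr => b _.
  by rewrite !mxE (gr_hom_ract gh) free_coord_ract vcoefM mulrC.
(* The label at j differs from c either in the vertex or in the degree. *)
move=> j; rewrite inE => jc; rewrite (gr_hom_ract gh) free_coord_ract vcoefM.
set y := free_coord j (f (free_gen K s i)).
suff -> : vcoef c.1 y = 0 by rewrite mulr0.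
have [vj|vj] := eqVneq (nth c t j).1 c.1; last first.
  rewrite /y -(free_coord_vertex c _ (ltn_ord j)) vcoefM.
  by rewrite vcoef_vertex (negPf vj) mul0r.
have yd : path_deg ((nth c t j).2 - c.2) y.
  apply: free_coord_deg => //; case: fh => _; apply.
  by rewrite -{1}(lI a); apply: free_gen_deg.
apply: vcoef_deg yd _; rewrite subr_eq0; apply: contra jc => /eqP kj.
by rewrite [nth _ _ _]surjective_pairing vj kj -surjective_pairing.
Qed.

End Rank.

Lemma fgp_free_iso_perm (s t : seq label) :
  fgp_iso (fgp_free K s) (fgp_free K t) -> perm_eq s t.
Proof.
move=> [f [g [fh gh fK gK]]]; apply/allP => c _ /=; rewrite eqn_leq.
by rewrite (free_label_count fh gh fK) (free_label_count gh fh gK).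
Qed.

End Structure.

(** * The group completion of a free monoid with a shift *)

Section LaurentCharacter.
Variable V : finType.
Local Notation label := (V * int)%type.
Local Notation Lfun := {ffun V -> laurent^o}.
Implicit Types (c : label) (s t : seq label) (k : int).

(** The label (v, k) stands for t^k in the copy of Z[t,t^-1] indexed by v. *)
Definition laurent_char s : Lfun :=
  [ffun v => \sum_(c <- s | c.1 == v) << 1 *g c.2 >>].

Lemma laurent_char_cat s t :
  laurent_char (s ++ t) = laurent_char s + laurent_char t.
Proof. by apply/ffunP => v; rewrite !ffunE big_cat. Qed.

Lemma laurent_char_nil : laurent_char [::] = 0.
Proof. by apply/ffunP => v; rewrite !ffunE big_nil. Qed.

(** The coefficient of t^k at v counts the occurrences of (v, k). *)
Lemma laurent_char_perm s t : perm_eq s t <-> laurent_char s = laurent_char t.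
Proof.
split=> [st|/ffunP st].
  by apply/ffunP => v; rewrite !ffunE (perm_big _ st).
have charE r (v : V) k :
    (laurent_char r v : laurent)@_k = (count_mem (v, k) r)%:R.
  rewrite ffunE raddf_sum /= -sum1_count natr_sum.
  rewrite [LHS]big_mkcond [RHS]big_mkcond.
  apply: eq_bigr => -[w l] _ /=; rewrite xpair_eqE mcoeffU.
  by case: (w == v) => //=; case: (l == k).
apply/allP => -[v k] _ /=; have := charE t v k; rewrite -st charE => /eqP.
by rewrite eqr_nat.
Qed.

Definition shift_labels k s : seq label := [seq (c.1, k + c.2) | c <- s].

Lemma laurent_char_shift k s :
  laurent_char (shift_labels k s) = (<< 1 *g k >> : laurent) *: laurent_char s.
Proof.
apply/ffunP => v; rewrite !ffunE big_map [RHS]mulr_sumr.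
by apply: eq_bigr => c _; rewrite [RHS]laurent_mulUU mulr1.
Qed.
End LaurentCharacter.

Section FreeMonoidCompletion.
Variables (V : finType) (M : cMonoid) (basis : V * int -> M).
Local Notation label := (V * int)%type.
Local Notation Lfun := {ffun V -> laurent^o}.
Implicit Types (s t : seq label) (k : int).

Definition basis_sum s : M :=
  \big[@cm_add M/cm_zero M]_(c <- s) basis c.

Hypothesis basis_span : forall a, exists s, a = basis_sum s.
Hypothesis basis_free :
  forall s t, basis_sum s = basis_sum t -> perm_eq s t.
Variable shift : int -> M -> M.
Hypothesis shiftD : forall k, {morph shift k : x y / cm_add x y}.
Hypothesis shift_basis :
  forall k c, shift k (basis c) = basis (c.1, k + c.2).
Hypothesis shift0 : forall k, shift k (cm_zero M) = cm_zero M.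

Local Notation G := (group_completion M).
Let act k : G -> G := gc_map (shift k).
Hypothesis actD : forall k, {morph act k : x y / ag_add x y}.
Hypothesis act0 : forall x, act 0 x = x.
Hypothesis actA : forall i j x, act i (act j x) = act (i + j) x.

Lemma basis_sum_cat s t :
  basis_sum (s ++ t) = cm_add (basis_sum s) (basis_sum t).
Proof. exact: big_cat. Qed.

Lemma shift_basis_sum k s :
  shift k (basis_sum s) = basis_sum (shift_labels k s).
Proof.
rewrite /basis_sum (big_morph _ (shiftD k) (shift0 k)) big_map.
by apply: eq_bigr => c _; apply: shift_basis.
Qed.

Definition basis_diff s t : G :=
  quot_class (@gc_rel M) (basis_sum s, basis_sum t).

Lemma basis_diffS (x : G) : exists st, x = basis_diff st.1 st.2.
Proof.
have [[a b] ->] := quot_classS x; have [s ->] := basis_span a.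
by have [t ->] := basis_span b; exists (s, t).
Qed.

(** A free commutative monoid is cancellative, and by [basis_free] its elements
    are distinguished by their characters; hence so are formal differences. *)
Lemma basis_diff_eq s t s' t' : basis_diff s t = basis_diff s' t' <->
  laurent_char s - laurent_char t = laurent_char s' - laurent_char t'.
Proof.
rewrite /basis_diff (quot_classP (@gc_rel_eqv M)).
split=> [[e /=]|/eqP].
  have [u ->] := basis_span e; rewrite -!basis_sum_cat => /basis_free.
  move/laurent_char_perm; rewrite !laurent_char_cat => /addIr E.
  by apply/eqP; rewrite subr_eq addrAC -E addrK.
rewrite subr_eq addrAC eq_sym subr_eq -!laurent_char_cat => /eqP.
move=> /laurent_char_perm st; exists (cm_zero M) => /=.
by rewrite -!basis_sum_cat; congr cm_add; apply/esym/perm_big.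
Qed.

(** Any representative by differences of basis sums will do, by
    [basis_diff_eq]. *)
Definition completion_char (x : G) : Lfun :=
  let st := sval (cid (basis_diffS x)) in
  laurent_char st.1 - laurent_char st.2.

Lemma completion_charE s t :
  completion_char (basis_diff s t) = laurent_char s - laurent_char t.
Proof. by rewrite /completion_char; case: cid => st /= /basis_diff_eq. Qed.

Lemma completion_char_inj : injective completion_char.
Proof.
move=> x y; have [[s t] ->] := basis_diffS x.
have [[s' t'] ->] := basis_diffS y.
by rewrite !completion_charE => /basis_diff_eq.
Qed.

Lemma completion_charD (x y : G) :
  completion_char (ag_add x y) = completion_char x + completion_char y.
Proof.
have [[s t] ->] := basis_diffS x; have [[s' t'] ->] := basis_diffS y.
rewrite !completion_charE /= gc_addE /gc_pair_add /= -!basis_sum_cat.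
by rewrite completion_charE !laurent_char_cat opprD addrACA.
Qed.

Lemma completion_char0 : completion_char (ag_zero G) = 0.
Proof.
by apply: (addrI (completion_char (ag_zero G))); rewrite -completion_charD
  ag_add0 addr0.
Qed.

Lemma completion_char_act k (x : G) :
  completion_char (act k x) = (<< 1 *g k >> : laurent) *: completion_char x.
Proof.
have [[s t] ->] := basis_diffS x; rewrite /act gc_mapE; last exact: shiftD.
rewrite /gc_pair_map /= !shift_basis_sum !completion_charE.
by rewrite !laurent_char_shift scalerBr.
Qed.

Lemma completion_char_mulz n (x : G) :
  completion_char (ag_mulz n x) = completion_char x *~ n.
Proof.
have ND y : completion_char (ag_opp y) = - completion_char y.
  by apply/eqP; rewrite -addr_eq0 -completion_charD ag_addN completion_char0.
elim/int_succ_ind: n => [|n IH|n IH]; first exact: completion_char0.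
  by rewrite ag_mulzS completion_charD IH mulrzDr addrC.
by rewrite ag_mulzP completion_charD ND IH mulrzBr addrC.
Qed.

Lemma completion_char_scale (a : laurent) (x : G) :
  completion_char (laurent_act act a x) = a *: completion_char x.
Proof.
rewrite {2}[a]monalgE scaler_suml.
rewrite /laurent_act (big_morph _ completion_charD completion_char0).
apply: eq_bigr => k _; rewrite completion_char_mulz completion_char_act.
rewrite scalerMzl; congr (_ *: _).
apply/malgP => l; rewrite raddfMz /= !mcoeffU.
by case: eqP => _; rewrite ?mul0rz // intz.
Qed.

(** The labels (v, 0) give the basis over Z[t,t^-1]. *)
Definition char_preimage (phi : Lfun) : G :=
  \big[@ag_add G/ag_zero G]_(v : V)
    laurent_act act (phi v) (basis_diff [:: (v, 0)] [::]).

Lemma char_preimageK phi : completion_char (char_preimage phi) = phi.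
Proof.
rewrite /char_preimage (big_morph _ completion_charD completion_char0).
apply/ffunP => w; rewrite sum_ffunE (bigD1 w) //= big1 => [|v vw].
  rewrite completion_char_scale completion_charE laurent_char_nil subr0 addr0.
  by rewrite !ffunE big_cons big_nil eqxx addr0; apply: mulr1.
rewrite completion_char_scale completion_charE laurent_char_nil subr0.
by rewrite !ffunE big_cons big_nil (negPf vw); apply: mulr0.
Qed.

(** The character is additive and turns the shift by k into multiplication by
    t^k, which makes it linear over Z[t,t^-1]. *)
Theorem free_completion_iso :
  lModule_iso (laurent_module actD act0 actA) (lModule_of_lmodType Lfun).
Proof.
exists completion_char; split=> [||a x].
- exists char_preimage; last exact: char_preimageK.
  by move=> x; apply: completion_char_inj; apply: char_preimageK.
- exact: completion_charD.
- exact: completion_char_scale.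
Qed.

End FreeMonoidCompletion.

(** * The graded Grothendieck group of the path algebra *)

Section IsoClasses.
Variables (K : fieldType) (E : digraph).
Local Notation A := (path_algebra K E).
Local Notation label := (vertex E * int)%type.
Implicit Types (c : label) (s t : seq label).

Definition label_class c : iso_class_monoid A :=
  quot_class (@fgp_iso A) (fgp_label K c).

Lemma label_class_sum s :
  basis_sum label_class s = quot_class (@fgp_iso A) (fgp_free K s).
Proof.
rewrite /basis_sum; elim: s => [|c s IH]; first by rewrite big_nil.
by rewrite big_cons IH; apply: iso_class_sumE.
Qed.

Lemma label_class_span (a : iso_class_monoid A) :
  exists s, a = basis_sum label_class s.
Proof.
have [P ->] := quot_classS a; have [s Ps] := fgp_iso_free P.
by exists s; rewrite label_class_sum; apply/(quot_classP (@fgp_iso_eqv A)).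
Qed.

Lemma label_class_free s t :
  basis_sum label_class s = basis_sum label_class t -> perm_eq s t.
Proof.
rewrite !label_class_sum => /(quot_classP (@fgp_iso_eqv A)).
exact: fgp_free_iso_perm.
Qed.

Lemma label_class_shift k c :
  iso_class_shift k (label_class c) = label_class (c.1, k + c.2).
Proof.
rewrite iso_class_shiftE; apply/(quot_classP (@fgp_iso_eqv A)).
exact: fgp_shift_shift.
Qed.

Lemma iso_class_shift0 k :
  iso_class_shift k (cm_zero (iso_class_monoid A))
  = cm_zero (iso_class_monoid A).
Proof.
rewrite [LHS]iso_class_shiftE; apply/(quot_classP (@fgp_iso_eqv A)).
by exists id, id; split.
Qed.

End IsoClasses.

Theorem theorem6p1p2 (K : fieldType) (E : digraph) :
  lModule_iso (K0gr (path_algebra K E))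
    (lModule_of_lmodType {ffun vertex E -> laurent^o}).
Proof.
apply: (free_completion_iso (@label_class_span K E) (@label_class_free K E)).
- exact: iso_class_shiftD.
- exact: label_class_shift.
- exact: iso_class_shift0.
Qed.
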